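(* Let $(\mathbb{B},\mathcal{F})$ be a coloured Boolean lattice (of finite rank $r$, with ordered atoms). Then the map $\phi:\mathcal{K}_*(\mathbb{B},\mathcal{F})\to\mathcal{C}_*(\mathbb{B},\mathcal{F})$ from the cube complex to the coloured poset complex, defined on $\lambda\in\mathcal{F}(x)$ by $\phi(\lambda)=\sum_{\mathbf{x}}\varepsilon_{\mathbf{x}}\,\lambda\,\mathbf{x}^\circ$ (sum over all saturated sequences $\mathbf{x}$ from $x$ to $1$), is a quasi-isomorphism, yielding isomorphisms $$H_n^\diamond(\mathbb{B},\mathcal{F})\;\cong\;H_n(\mathbb{B},\mathcal{F})$$ for all $n$.
   Context: $R$ is a unital commutative ring. A poset is viewed as a category with a unique morphism $x\to y$ when $x\le y$. Write $x<_c y$ ($y$ covers $x$) if $x<y$ and there is no $z$ with $x<z<y$. Coloured Boolean lattice: $\mathbb{B}$ is a poset isomorphic to the lattice of subsets of a finite set with $r$ elements, ordered by inclusion ($r$ is the rank of $\mathbb{B}$; $\mathrm{rk}(x)$ is the cardinality of the subset corresponding to $x$), with its atoms (rank $1$ elements) given a fixed ordering $a_1,\dots,a_r$, and $\mathcal{F}:\mathbb{B}\to R\text{-Mod}$ is a covariant functor (the colouring). Write $\mathcal{F}_x^y=\mathcal{F}(x\le y)$ and $1=1_{\mathbb{B}}$ for the maximum. Each $x\in\mathbb{B}$ is uniquely a join $a_{i_1}\vee\cdots\vee a_{i_k}$ with $i_1<\cdots<i_k$. Coloured poset complexes and homology: $\mathcal{S}_k(\mathbb{B},\mathcal{F})=\bigoplus_{x_1\le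 x_2\le\cdots\le x_k}\mathcal{F}(x_1)$ for $k>0$, the sum over multi-sequences with all $x_i\in\mathbb{B}\setminus\{1\}$; $\mathcal{S}_0=\mathcal{F}(1)$; $\mathcal{S}_k=0$ for $k<0$. The element $\lambda\in\mathcal{F}(x_1)$ in the summand indexed by $\mathbf{x}=x_1\cdots x_k$ is written $\lambda x_1\cdots x_k$. The differential is $$d(\lambda x_1\cdots x_k)=\mathcal{F}_{x_1}^{x_2}(\lambda)\,x_2\cdots x_k-\sum_{i=2}^k(-1)^i\lambda\,x_1\cdots\widehat{x}_i\cdots x_k\quad(k>1),\qquad d(\lambda x)=\mathcal{F}_x^1(\lambda)\quad(k=1).$$ $\mathcal{C}_*(\mathbb{B},\mathcal{F})\subset\mathcal{S}_*(\mathbb{B},\mathcal{F})$ is the subcomplex with $\mathcal{C}_0=\mathcal{F}(1)$ and, for $k>0$, only the summands indexed by strictly increasing sequences $x_1<\cdots<x_k$ in $\mathbb{B}\setminus\{1\}$. The homology of the coloured poset is $H_n(\mathbb{B},\mathcal{F})=H_n(\mathcal{S}_*(\mathbb{B},\mathcal{F}))$; the inclusion $\mathcal{C}_*\subset\mathcal{S}_*$ is a homotopy equivalence and $H_n(\mathbb{B},\mathcal{F})$ is identified with $H_n(\mathcal{C}_*(\mathbb{B},\mathcal{F}))$ through it. Signs: if $x<_c y$, then $y=x\vee a_\ell$ for a unique atom $a_\ell\not\le x$, and $\varepsilon(x<_c y)=(-1)^j$, where $j$ is the number of atoms appearing before $a_\ell$ in the unique expression for $y$ as an ordered join of atoms.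 A saturated sequence is $\mathbf{x}=x_1<_c x_2<_c\cdots<_c x_k$; set $\varepsilon_{\mathbf{x}}=\prod_{i}\varepsilon(x_i<_c x_{i+1})$. Cube complex: $\mathcal{K}_k(\mathbb{B},\mathcal{F})=\bigoplus_{\mathrm{rk}\,x=r-k}\mathcal{F}(x)$, with differential $d(\lambda)=\sum_{y:\,x<_c y}\varepsilon(x<_c y)\mathcal{F}_x^y(\lambda)$ for $\lambda\in\mathcal{F}(x)$. Its homology is $H^\diamond_n(\mathbb{B},\mathcal{F})=H_n(\mathcal{K}_*(\mathbb{B},\mathcal{F}))$. The map $\phi$: for $\lambda\in\mathcal{F}(x)$ and a saturated sequence $\mathbf{x}=x_1<_c\cdots<_c x_k$ with $x_1=x$ and $x_k=1$, put $\mathbf{x}^\circ=x_1<_c\cdots<_c x_{k-1}$; $\phi:\mathcal{K}_n(\mathbb{B},\mathcal{F})\to\mathcal{C}_n(\mathbb{B},\mathcal{F})$ is $\phi(\lambda)=\sum_{\mathbf{x}}\varepsilon_{\mathbf{x}}\lambda\,\mathbf{x}^\circ$ (for $x=1$ this is the identity of $\mathcal{F}(1)$). *)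

(* Defs.v *)
From HB Require Import structures.
From mathcomp Require Import all_boot all_order all_algebra.
From mathcomp Require Import boolp.

Set Implicit Arguments.
Unset Strict Implicit.
Unset Printing Implicit Defensive.

Import Order.TTheory GRing.Theory.

Local Open Scope ring_scope.
Local Open Scope quotient_scope.

(* Direct sums over a finite index type, realised as dependent functions. *)
Section DirectSum.
Variables (R : pzRingType) (I : finType) (M : I -> lmodType R).

Definition dsum : Type := {dffun forall i, M i}.

HB.instance Definition _ := Choice.copy dsum {dffun forall i, M i}.

Definition dsum_of (f : forall i, M i) : dsum := [ffun i => f i].

Lemma dsum_ofE f i : dsum_of f i = f i.
Proof. by rewrite /dsum_of ffunE. Qed.

Lemma dsumP (u v : dsum) : (forall i, u i = v i) -> u = v.
Proof. by move=> uv; apply/ffunP. Qed.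

Definition dsum_zero : dsum := dsum_of (fun=> 0).
Definition dsum_opp (u : dsum) : dsum := dsum_of (fun i => - u i).
Definition dsum_add (u v : dsum) : dsum := dsum_of (fun i => u i + v i).
Definition dsum_scale (a : R) (u : dsum) : dsum := dsum_of (fun i => a *: u i).

Fact dsum_addA : associative dsum_add.
Proof. by move=> u v w; apply: dsumP => i; rewrite !dsum_ofE addrA. Qed.
Fact dsum_addC : commutative dsum_add.
Proof. by move=> u v; apply: dsumP => i; rewrite !dsum_ofE addrC. Qed.
Fact dsum_add0 : left_id dsum_zero dsum_add.
Proof. by move=> u; apply: dsumP => i; rewrite !dsum_ofE add0r. Qed.
Fact dsum_addN : left_inverse dsum_zero dsum_opp dsum_add.
Proof. by move=> u; apply: dsumP => i; rewrite !dsum_ofE addNr. Qed.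

HB.instance Definition _ :=
  GRing.isZmodule.Build dsum dsum_addA dsum_addC dsum_add0 dsum_addN.

Fact dsum_scaleA a b u :
  dsum_scale a (dsum_scale b u) = dsum_scale (a * b) u.
Proof. by apply: dsumP => i; rewrite !dsum_ofE scalerA. Qed.
Fact dsum_scale1 : left_id 1 dsum_scale.
Proof. by move=> u; apply: dsumP => i; rewrite !dsum_ofE scale1r. Qed.
Fact dsum_scaleDr : right_distributive dsum_scale +%R.
Proof. by move=> a u v; apply: dsumP => i; rewrite !dsum_ofE scalerDr. Qed.
Fact dsum_scaleDl u : {morph dsum_scale^~ u : a b / a + b}.
Proof. by move=> a b; apply: dsumP => i; rewrite !dsum_ofE scalerDl. Qed.

HB.instance Definition _ := GRing.Zmodule_isLmodule.Build R dsum
  dsum_scaleA dsum_scale1 dsum_scaleDr dsum_scaleDl.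

Lemma dsumDE (u v : dsum) i : (u + v) i = u i + v i.
Proof. exact: dsum_ofE. Qed.
Lemma dsumZE a (u : dsum) i : (a *: u) i = a *: u i.
Proof. exact: dsum_ofE. Qed.
Lemma dsum0E i : (0 : dsum) i = 0.
Proof. exact: dsum_ofE. Qed.
Lemma dsum_sumE (J : Type) (r : seq J) (P : pred J) (f : J -> dsum) i :
  (\sum_(j <- r | P j) f j) i = \sum_(j <- r | P j) f j i.
Proof.
elim: r => [|j r IH]; first by rewrite !big_nil dsum0E.
by rewrite !big_cons; case: (P j); rewrite ?dsumDE IH.
Qed.

(* x placed in the summand of index i. *)
Definition dsum_in i (x : M i) : dsum := dsum_of (@dfwith I M (fun j => 0 : M j) i x).

Lemma dsum_in_id i (x : M i) : dsum_in x i = x.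
Proof. by rewrite dsum_ofE dfwith_in. Qed.
Lemma dsum_in_neq i (x : M i) j : i != j -> dsum_in x j = 0.
Proof. by move=> ij; rewrite dsum_ofE dfwith_out. Qed.

Fact dsum_in_linear i : linear (@dsum_in i).
Proof.
move=> a x y; apply: dsumP => j; rewrite dsumDE dsumZE.
have [<-|ij] := eqVneq i j; first by rewrite !dsum_in_id.
by rewrite !dsum_in_neq // scaler0 addr0.
Qed.
HB.instance Definition _ i :=
  GRing.isLinear.Build R (M i) dsum *:%R (@dsum_in i) (@dsum_in_linear i).

Lemma dsum_decomp (u : dsum) : u = \sum_i dsum_in (u i).
Proof.
apply: dsumP => j; rewrite dsum_sumE (bigD1 j) //= dsum_in_id big1 ?addr0 //.
by move=> i ij; rewrite dsum_in_neq.
Qed.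

Variable N : lmodType R.

Definition dsum_case (g : forall i, {linear M i -> N}) (u : dsum) : N :=
  \sum_i g i (u i).

Fact dsum_case_linear g : linear (dsum_case g).
Proof.
move=> a u v; rewrite /dsum_case scaler_sumr -big_split /=.
by apply: eq_bigr => i _; rewrite dsumDE dsumZE linearP.
Qed.
HB.instance Definition _ g :=
  GRing.isLinear.Build R dsum N *:%R (dsum_case g) (dsum_case_linear g).

Lemma dsum_case_in g i x : dsum_case g (@dsum_in i x) = g i x.
Proof.
rewrite /dsum_case (bigD1 i) //= dsum_in_id big1 ?addr0 // => j ji.
by rewrite dsum_in_neq ?linear0 // eq_sym.
Qed.

Lemma dsum_linear_ext (f g : {linear dsum -> N}) :
  (forall i x, f (@dsum_in i x) = g (@dsum_in i x)) -> f =1 g.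
Proof.
by move=> fg u; rewrite (dsum_decomp u) !linear_sum; apply: eq_bigr.
Qed.

End DirectSum.

Section LmodQuotient.
Variables (R : pzRingType) (V : lmodType R) (W : {pred V}).
Hypothesis WP : subsemimod_closed W.

Definition submod_pred of subsemimod_closed W : {pred V} := W.
HB.instance Definition _ :=
  GRing.isSubmodClosed.Build R V (submod_pred WP) WP.

Definition lmod_quot : Type := Quotient.quot (submod_pred WP).
HB.instance Definition _ := GRing.Zmodule.on lmod_quot.

Definition lmod_quot_pi (v : V) : lmod_quot := \pi_(Quotient.quot (submod_pred WP)) v.

Lemma lmod_quot_eq u v : (lmod_quot_pi u == lmod_quot_pi v) = (u - v \in W).
Proof. by rewrite -(Quotient.idealrBE (submod_pred WP)). Qed.

Definition lmod_quot_repr (q : lmod_quot) : V := repr (q : Quotient.quot (submod_pred WP)).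

Lemma lmod_quot_reprK : cancel lmod_quot_repr lmod_quot_pi.
Proof. by move=> q; apply: reprK. Qed.

Fact lmod_quot_pi_zmod : zmod_morphism lmod_quot_pi.
Proof. by move=> u v; rewrite /lmod_quot_pi !piE. Qed.

Definition lmod_quot_scale (a : R) (q : lmod_quot) : lmod_quot :=
  lmod_quot_pi (a *: lmod_quot_repr q).

Lemma lmod_quot_piZ a v :
  lmod_quot_pi (a *: v) = lmod_quot_scale a (lmod_quot_pi v).
Proof.
apply/eqP; rewrite lmod_quot_eq -scalerBr; apply: WP.2.
by rewrite -lmod_quot_eq lmod_quot_reprK.
Qed.

Fact lmod_quot_piD u v : lmod_quot_pi (u + v) = lmod_quot_pi u + lmod_quot_pi v.
Proof. by rewrite /lmod_quot_pi !piE. Qed.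

Fact lmod_quot_scaleA a b q :
  lmod_quot_scale a (lmod_quot_scale b q) = lmod_quot_scale (a * b) q.
Proof. by rewrite -[q]lmod_quot_reprK -!lmod_quot_piZ scalerA. Qed.
Fact lmod_quot_scale1 : left_id 1 lmod_quot_scale.
Proof. by move=> q; rewrite -[q]lmod_quot_reprK -!lmod_quot_piZ scale1r. Qed.
Fact lmod_quot_scaleDr : right_distributive lmod_quot_scale +%R.
Proof.
move=> a p q; rewrite -[p]lmod_quot_reprK -[q]lmod_quot_reprK.
by rewrite -!(lmod_quot_piZ, lmod_quot_piD) scalerDr.
Qed.
Fact lmod_quot_scaleDl q : {morph lmod_quot_scale^~ q : a b / a + b}.
Proof.
move=> a b; rewrite -[q]lmod_quot_reprK.
by rewrite -!(lmod_quot_piZ, lmod_quot_piD) scalerDl.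
Qed.

HB.instance Definition _ := GRing.Zmodule_isLmodule.Build R lmod_quot
  lmod_quot_scaleA lmod_quot_scale1 lmod_quot_scaleDr lmod_quot_scaleDl.

Fact lmod_quot_pi_linear : linear lmod_quot_pi.
Proof. by move=> a u v; rewrite lmod_quot_piD lmod_quot_piZ. Qed.
HB.instance Definition _ :=
  GRing.isLinear.Build R V lmod_quot *:%R lmod_quot_pi lmod_quot_pi_linear.

End LmodQuotient.

Section ChainComplexes.
Variable R : pzRingType.

(* Complexes are graded by nat: the modules of negative degree and the
   differential out of degree 0 are zero. *)
Record chain_complex := ChainComplex {
  chain_obj :> nat -> lmodType R;
  chain_diff : forall n, {linear chain_obj n.+1 -> chain_obj n};
  chain_diff2 : forall n u, chain_diff n (chain_diff n.+1 u) = 0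
}.

Record chain_map (C D : chain_complex) := ChainMap {
  chain_map_fun :> forall n, {linear C n -> D n};
  chain_map_comm : forall n u,
    chain_map_fun n (chain_diff C n u) = chain_diff D n (chain_map_fun n.+1 u)
}.

Section Homology.
Variables (C : chain_complex) (n : nat).

Definition is_cycle : pred (C n) :=
  match n return pred (C n) with
  | 0 => predT
  | m.+1 => fun u => chain_diff C m u == 0
  end.

Fact is_cycle_submod : subsemimod_closed is_cycle.
Proof.
rewrite /is_cycle; case: n => [|m]; first by do !split.
split; first split; first by apply/eqP; rewrite linear0.
  by move=> u v /eqP u0 /eqP v0; apply/eqP; rewrite linearD u0 v0 addr0.
by move=> a u /eqP u0; apply/eqP; rewrite linearZ /= u0 scaler0.
Qed.
HB.instance Definition _ :=
  GRing.isSubmodClosed.Build R (C n) is_cycle is_cycle_submod.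

Definition cycles : Type := {u : C n | is_cycle u}.
HB.instance Definition _ := SubChoice.on cycles.
HB.instance Definition _ := [SubChoice_isSubLmodule of cycles by <:].

Definition is_boundary : pred cycles :=
  fun z => `[< exists v : C n.+1, val z = chain_diff C n v >].

Fact is_boundary_submod : subsemimod_closed is_boundary.
Proof.
split; first split.
- by apply/asboolP; exists 0; rewrite linear0 raddf0.
- move=> y z /asboolP[u yu] /asboolP[v zv]; apply/asboolP.
  by exists (u + v); rewrite linearD raddfD /= yu zv.
- move=> a z /asboolP[v zv]; apply/asboolP.
  by exists (a *: v); rewrite !linearZ /= zv.
Qed.
Definition homology : lmodType R := lmod_quot is_boundary_submod.

End Homology.

Section HomologyMap.
Variables (C D : chain_complex) (f : chain_map C D) (n : nat).

Fact cycle_map_subproof (z : cycles C n) : is_cycle (f n (val z)).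
Proof.
case: n z => [|m] [u /= cu] //=.
by rewrite -chain_map_comm (eqP cu) linear0.
Qed.

Definition cycle_map (z : cycles C n) : cycles D n :=
  exist _ (f n (val z)) (cycle_map_subproof z).

Definition homology_map (h : homology C n) : homology D n :=
  lmod_quot_pi (@is_boundary_submod D n) (cycle_map (lmod_quot_repr h)).

Lemma homology_map_pi z :
  homology_map (lmod_quot_pi (@is_boundary_submod C n) z) =
  lmod_quot_pi (@is_boundary_submod D n) (cycle_map z).
Proof.
apply/eqP; rewrite lmod_quot_eq.
set z' := lmod_quot_repr _.
have : z' - z \in @is_boundary C n.
  by rewrite -(lmod_quot_eq (@is_boundary_submod C n)) /z' lmod_quot_reprK.
case/asboolP=> v zv; apply/asboolP; exists (f n.+1 v).
by rewrite -chain_map_comm -zv !linearB.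
Qed.

Fact homology_map_linear : linear homology_map.
Proof.
move=> a p q; rewrite -[p]lmod_quot_reprK -[q]lmod_quot_reprK -linearP.
rewrite !homology_map_pi -linearP; congr lmod_quot_pi.
by apply: val_inj; rewrite /= !linearP.
Qed.
HB.instance Definition _ := GRing.isLinear.Build R (homology C n) (homology D n)
  *:%R homology_map homology_map_linear.

End HomologyMap.

Definition quasi_isomorphism (C D : chain_complex) (f : chain_map C D) : Prop :=
  forall n, bijective (@homology_map C D f n).

End ChainComplexes.

Arguments homology_map {R C D} f n h.

(* An isomorphism of B with the subsets of an r-element set, and an enumeration
   of the atoms; it lists all of them since there are exactly r. *)
Record boolean_lattice (r : nat) (d : Order.disp_t) (B : finTBLatticeType d) :=
  BooleanLattice {
    bl_base : finType;
    bl_card : #|bl_base| = r;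
    bl_set : B -> {set bl_base};
    bl_set_bij : bijective bl_set;
    bl_set_le : forall x y : B, (x <= y)%O = (bl_set x \subset bl_set y);
    bl_atom : 'I_r -> B;
    bl_atom_inj : injective bl_atom;
    bl_atom_rank : forall i, #|bl_set (bl_atom i)| = 1%N
  }.

Definition covers (d : Order.disp_t) (B : finPOrderType d) : rel B :=
  fun x y => (x < y)%O && [forall z, ~~ ((x < z)%O && (z < y)%O)].

Lemma covers_le (d : Order.disp_t) (B : finPOrderType d) (x y : B) :
  covers x y -> (x <= y)%O.
Proof. by case/andP => /ltW. Qed.

Section BooleanLatticeTheory.
Variables (r : nat) (d : Order.disp_t) (B : finTBLatticeType d).
Variable L : boolean_lattice r B.
Local Notation a := (bl_atom L).

Definition rk (x : B) : nat := #|bl_set L x|.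

(* The index set of the expression of x as a join of atoms, see join_atomsE. *)
Definition atoms_below (x : B) : {set 'I_r} := [set i | (a i <= x)%O].

(* The atom a_l with y = x \/ a_l and a_l not below x, when y covers x. *)
Definition new_atom (x y : B) : option 'I_r :=
  [pick l | ~~ (a l <= x)%O && (y == x `|` a l)%O].

Definition cover_sign (R : pzRingType) (x y : B) : R :=
  if new_atom x y is Some l
  then (-1) ^+ #|[set i in atoms_below y | (i < l)%N]| else 1.

Lemma bl_set_inj : injective (bl_set L).
Proof. exact: bij_inj (bl_set_bij L). Qed.

Lemma atom_setP : {t : 'I_r -> bl_base L |
  bijective t & forall i, bl_set L (a i) = [set t i]}.
Proof.
have aP i : exists t, bl_set L (a i) == [set t].
  by have /eqP/cards1P[t ->] := bl_atom_rank L i; exists t.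
pose t i := xchoose (aP i).
have tP i : bl_set L (a i) = [set t i] by apply/eqP/(xchooseP (aP i)).
exists t => //; apply: inj_card_bij; last by rewrite card_ord bl_card.
move=> i j tij; apply: (@bl_atom_inj _ _ _ L); apply: bl_set_inj.
by rewrite !tP tij.
Qed.

Lemma atoms_belowE : {t : 'I_r -> bl_base L |
  bijective t & forall x, atoms_below x = t @^-1: bl_set L x}.
Proof.
have [t tbij tP] := atom_setP; exists t => // x.
by apply/setP => i; rewrite !inE (bl_set_le L) tP sub1set.
Qed.

Lemma atoms_below_le x y : (x <= y)%O = (atoms_below x \subset atoms_below y).
Proof.
have [t [t' tK t'K] tP] := atoms_belowE; rewrite (bl_set_le L) !tP.
apply/subsetP/subsetP => xy i.
  by rewrite !inE; apply: xy.
by have := xy (t' i); rewrite !inE t'K.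
Qed.

Lemma atoms_below_inj : injective atoms_below.
Proof.
by move=> x y xy; apply/eqP; rewrite eq_le !atoms_below_le xy subxx.
Qed.

Lemma atoms_below_surj (I : {set 'I_r}) : exists x, atoms_below x = I.
Proof.
have [t [t' tK t'K] tP] := atoms_belowE.
have [g gK Kg] := bl_set_bij L.
exists (g (t' @^-1: I)); rewrite tP Kg.
by apply/setP => i; rewrite !inE tK.
Qed.

Lemma rk_atoms x : rk x = #|atoms_below x|.
Proof.
have [t tbij tP] := atoms_belowE; rewrite tP on_card_preimset //.
exact: onW_bij.
Qed.

Lemma atoms_below_atom i : atoms_below (a i) = [set i].
Proof.
have [t tbij tP] := atom_setP; apply/setP=> j.
by rewrite !inE (bl_set_le L) !tP sub1set inE (inj_eq (bij_inj tbij)).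
Qed.

Lemma atoms_below_bot : atoms_below \bot%O = set0.
Proof.
have [x x0] := atoms_below_surj set0; apply/eqP.
by rewrite -subset0 -x0 -atoms_below_le le0x.
Qed.

Lemma atoms_below_top : atoms_below \top%O = setT.
Proof.
have [x xT] := atoms_below_surj setT; apply/eqP.
by rewrite eqEsubset subsetT -xT -atoms_below_le lex1.
Qed.

Lemma atoms_below_join x y :
  atoms_below (x `|` y)%O = atoms_below x :|: atoms_below y.
Proof.
apply/eqP; rewrite eqEsubset; apply/andP; split; last first.
  by rewrite subUset -!atoms_below_le leUl leUr.
have [z zE] := atoms_below_surj (atoms_below x :|: atoms_below y).
by rewrite -zE -atoms_below_le leUx !atoms_below_le zE subsetUl subsetUr.
Qed.

Lemma join_atomsE (x : B) (I : {set 'I_r}) :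
  (\join_(i in I) a i)%O = x <-> I = atoms_below x.
Proof.
have joinE (J : {set 'I_r}) : atoms_below (\join_(i in J) a i)%O = J.
  rewrite (big_morph _ atoms_below_join atoms_below_bot).
  under eq_bigr do rewrite atoms_below_atom.
  apply/setP => j; apply/bigcupP/idP => [[i iJ /set1P->]|jJ] //.
  by exists j; rewrite ?inE.
split=> [<-|->]; first by rewrite joinE.
by apply: atoms_below_inj; rewrite joinE.
Qed.

Lemma coversP x y : reflect
  (exists2 l, l \notin atoms_below x & atoms_below y = l |: atoms_below x)
  (covers x y).
Proof.
apply: (iffP andP) => [[xy /forallP no]|[l lx yE]].
  have /properP[xSy [l ly lx]] : atoms_below x \proper atoms_below y.
    by rewrite properEneq -atoms_below_le (inj_eq atoms_below_inj) -lt_neqAle.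
  exists l => //.
  have [z zE] := atoms_below_surj (l |: atoms_below x).
  have xz : (x < z)%O.
    rewrite lt_neqAle atoms_below_le zE subsetUr andbT.
    by apply: contraNneq lx => ->; rewrite zE !inE eqxx.
  have zy : (z <= y)%O by rewrite atoms_below_le zE subUset sub1set ly xSy.
  move: (no z); rewrite xz /= lt_neqAle zy andbT negbK => /eqP <-.
  exact: zE.
split.
  rewrite lt_neqAle atoms_below_le yE subsetUr andbT.
  by apply: contraNneq lx => ->; rewrite yE !inE eqxx.
apply/forallP=> z; apply/negP => /andP[xz zy].
have := proper_card (A := atoms_below x) (B := atoms_below z).
rewrite properEneq -atoms_below_le (inj_eq atoms_below_inj) -lt_neqAle xz.
have := proper_card (A := atoms_below z) (B := atoms_below y).
rewrite properEneq -atoms_below_le (inj_eq atoms_below_inj) -lt_neqAle zy.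
rewrite yE cardsU1 lx add1n => /(_ isT) h1 /(_ isT) h2.
by move: (leq_trans h2 h1); rewrite ltnn.
Qed.

Lemma covers_rk x y : covers x y -> rk y = (rk x).+1.
Proof. by case/coversP=> l lx yE; rewrite !rk_atoms yE cardsU1 lx. Qed.

Lemma cover_signE (R : pzRingType) x y l :
  l \notin atoms_below x -> atoms_below y = l |: atoms_below x ->
  cover_sign R x y = (-1) ^+ #|[set i in atoms_below x | (i < l)%N]|.
Proof.
move=> lx yE; rewrite /cover_sign /new_atom.
case: pickP => [m /= /andP[mx /eqP yE']|no].
  have: m \in atoms_below y by rewrite yE' inE leUr.
  rewrite yE in_setU1 [m \in _]inE (negPf mx) orbF => /eqP ->.
  congr (_ ^+ _); apply: eq_card => i; rewrite [LHS]in_set [RHS]in_set in_setU1.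
  by case: (eqVneq i l) => //= ->; rewrite ltnn !andbF.
have := no l; move: (lx); rewrite inE => lx'; rewrite lx' /=; case/eqP.
by apply: atoms_below_inj; rewrite atoms_below_join atoms_below_atom yE setUC.
Qed.

End BooleanLatticeTheory.

Record colouring (R : pzRingType) (d : Order.disp_t) (B : porderType d) :=
  Colouring {
    col_obj :> B -> lmodType R;
    col_map : forall x y : B, (x <= y)%O -> {linear col_obj x -> col_obj y};
    col_id : forall (x : B) (xx : (x <= x)%O) u, col_map xx u = u;
    col_comp : forall (x y z : B) (xy : (x <= y)%O) (yz : (y <= z)%O)
      (xz : (x <= z)%O) u, col_map yz (col_map xy u) = col_map xz u
  }.

Section ColouringTheory.
Variables (R : pzRingType) (d : Order.disp_t) (B : porderType d).
Variable F : colouring R B.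

(* F_x^y, extended by 0 to the pairs that are not x <= y. *)
Definition col_trans (x y : B) : {linear F x -> F y} :=
  match @idP (x <= y)%O with
  | ReflectT xy => col_map F xy
  | ReflectF _ => \0
  end.

Lemma col_transE x y (xy : (x <= y)%O) : col_trans x y =1 col_map F xy.
Proof.
move=> u; rewrite /col_trans; case: {-}_ / idP => // xy'.
by rewrite (bool_irrelevance xy' xy).
Qed.

Lemma col_trans_id x u : col_trans x x u = u.
Proof. by rewrite (col_transE (lexx x)) col_id. Qed.

Lemma col_trans_comp x y z u : (x <= y)%O -> (y <= z)%O ->
  col_trans y z (col_trans x y u) = col_trans x z u.
Proof.
move=> xy yz; rewrite (col_transE xy) (col_transE yz).
by rewrite (col_transE (le_trans xy yz)) (col_comp _ _ (le_trans xy yz)).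
Qed.

End ColouringTheory.

Definition delete (T : Type) (i : nat) (s : seq T) : seq T :=
  take i s ++ drop i.+1 s.

Lemma delete_subseq (T : eqType) i (s : seq T) : subseq (delete i s) s.
Proof.
elim: s i => [|x s IH] [|i] //; last by rewrite /= eqxx; apply: IH.
by rewrite /delete take0 drop1; apply: subseq_cons.
Qed.

Lemma size_delete (T : Type) i (s : seq T) :
  (i < size s)%N -> size (delete i s) = (size s).-1.
Proof. by elim: s i => [|x [|y s] IH] [|i] //= si; rewrite IH. Qed.

Lemma delete_delete (T : Type) i j (s : seq T) :
  (i <= j)%N -> delete j (delete i s) = delete i (delete j.+1 s).
Proof.
rewrite /delete; elim: s i j => [|x s IH] [|i] [|j] //= ij; rewrite ?drop0 //=.
by rewrite IH.
Qed.

Lemma alternating_sum0 (V : zmodType) n (G : nat -> nat -> V) :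
  (forall i j, (i <= j < n)%N -> G i j = - G j.+1 i) ->
  \sum_(i < n.+1) \sum_(j < n) G i j = 0.
Proof.
elim: n => [|n IH] GN; first by apply: big1 => i _; rewrite big_ord0.
rewrite big_ord_recr /=.
under eq_bigr do rewrite big_ord_recr /=.
rewrite big_split /= IH ?add0r => [|i j /andP[ij jn]]; last first.
  by rewrite GN // ij ltnW.
rewrite -big_split /=; apply: big1 => i _.
by rewrite GN ?addNr // -ltnS ltn_ord ltnSn.
Qed.

Lemma skew_sum0 (V : zmodType) n (G : 'I_n -> 'I_n -> V) :
  (forall i j, i != j -> G i j = - G j i) ->
  \sum_i \sum_(j | i != j) G i j = 0.
Proof.
move=> GN; transitivity
  (\sum_(i < n) \sum_(j < n | (i < j)%N) G i j +
     \sum_(i < n) \sum_(j < n | (j < i)%N) G i j).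
  rewrite -big_split /=; apply: eq_bigr => i _.
  rewrite (bigID (fun j : 'I_n => (i < j)%N)) /=.
  congr (_ + _); apply: eq_bigl => j; rewrite -val_eqE /=; case: ltngtP => //.
have -> : \sum_(i < n) \sum_(j < n | (j < i)%N) G i j =
          \sum_(j < n) \sum_(i < n | (j < i)%N) G i j.
  by rewrite (exchange_big_dep xpredT).
rewrite -big_split /=; apply: big1 => i _; rewrite -big_split /=.
by apply: big1 => j ij; rewrite GN ?addNr // -val_eqE /= neq_ltn ij.
Qed.

Section PosetComplex.
Variables (R : pzRingType) (d : Order.disp_t) (B : finTBLatticeType d).
Variable F : colouring R B.

(* weak = true gives the multi-sequences x_1 <= ... <= x_k, weak = false the
   sequences x_1 < ... < x_k. *)
Section Chains.
Variable weak : bool.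

Definition is_chain (s : seq B) : bool :=
  sorted (fun x y => x < y ?<= if weak)%O s && (\top%O \notin s).

Lemma is_chain_subseq s t : subseq s t -> is_chain t -> is_chain s.
Proof.
move=> st /andP[tsort ttop]; apply/andP; split.
  apply: subseq_sorted st tsort => y x z xy yz.
  by have := lteif_trans xy yz; rewrite andbb.
by apply: contra ttop; apply: mem_subseq.
Qed.

Definition chain (k : nat) : Type := {t : k.-tuple B | is_chain t}.
HB.instance Definition _ k := Finite.copy (chain k) {t : k.-tuple B | is_chain t}.

Definition chain_seq k (s : chain k) : seq B := val (val s).

(* The first term; it is 1 for the empty sequence, so that the complexes below
   are F(1) in degree 0 and d(u x) = F_x^1(u). *)
Definition chain_head k (s : chain k) : B := head \top%O (chain_seq s).

Fact face_size k (s : chain k.+1) (i : 'I_k.+1) :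
  size (delete i (chain_seq s)) == k.
Proof. by rewrite size_delete size_tuple. Qed.

Fact face_chain k (s : chain k.+1) (i : 'I_k.+1) :
  is_chain (Tuple (face_size s i)).
Proof. exact: is_chain_subseq (delete_subseq _ _) (valP s). Qed.

Definition face k (s : chain k.+1) (i : 'I_k.+1) : chain k :=
  exist _ (Tuple (face_size s i)) (face_chain s i).

Lemma chain_head_face k (s : chain k.+1) i :
  (chain_head s <= chain_head (face s i))%O.
Proof.
have /andP[] := valP s; have := size_tuple (val s).
rewrite /chain_head -[chain_seq (face s i)]/(delete i (chain_seq s)) /delete.
rewrite -/(chain_seq s); case: (chain_seq s) => [|x t] //= _ xt _.
case: (nat_of_ord i) => [|j] /=; rewrite ?lexx //.
by case: t xt => [|y t] /=; [rewrite lex1 | case/andP=> /lteifW].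
Qed.

Lemma chain_head_face_gt0 k (s : chain k.+1) (i : 'I_k.+1) :
  (0 < i)%N -> chain_head (face s i) = chain_head s.
Proof.
have := size_tuple (val s).
rewrite /chain_head -[chain_seq (face s i)]/(delete i (chain_seq s)) /delete.
rewrite -/(chain_seq s); case: (chain_seq s) => [|x t] //= _.
by case: (nat_of_ord i).
Qed.

Definition poset_obj (k : nat) : lmodType R :=
  dsum (fun s : chain k => F (chain_head s)).

(* i counts from 0, so (-1)^i is the sign - (-1)^(i+1) of the deletion of the
   (i+1)-st term. Deleting the first term transports u along F_{x_1}^{x_2};
   for i > 0 the head is unchanged (chain_head_face_gt0) and the transport is
   the identity (col_trans_id). *)
Definition chain_bdry k (s : chain k.+1) (u : F (chain_head s)) : poset_obj k :=
  \sum_(i < k.+1) (-1) ^+ i *: dsum_in (i := face s i) (col_trans F _ _ u).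

Fact chain_bdry_linear k (s : chain k.+1) : linear (@chain_bdry k s).
Proof.
move=> c u v; rewrite /chain_bdry scaler_sumr -big_split; apply: eq_bigr => i _.
by rewrite !linearP /= scalerDr !scalerA commr_sign.
Qed.
HB.instance Definition _ k (s : chain k.+1) := GRing.isLinear.Build R
  (F (chain_head s)) (poset_obj k) *:%R (@chain_bdry k s) (@chain_bdry_linear k s).

Definition poset_diff k : {linear poset_obj k.+1 -> poset_obj k} :=
  dsum_case (fun s : chain k.+1 => @chain_bdry k s).

Lemma poset_diff_in k (s : chain k.+1) (u : F (chain_head s)) :
  poset_diff k (dsum_in (i := s) u) = chain_bdry u.
Proof. exact: dsum_case_in. Qed.


Fact poset_diff2 k u : poset_diff k (poset_diff k.+1 u) = 0.
Proof.
pose dd : {linear poset_obj k.+2 -> poset_obj k} :=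
  poset_diff k \o poset_diff k.+1.
suff: dd =1 (\0 : {linear poset_obj k.+2 -> poset_obj k}) by apply.
apply: dsum_linear_ext => s {}u /=; rewrite poset_diff_in linear_sum /=.
pose tm (t : chain k) : poset_obj k :=
  dsum_in (i := t) (col_trans F (chain_head s) (chain_head t) u).
pose G i j := (-1) ^+ (i + j) *: tm (face (face s (inord i)) (inord j)).
rewrite -[RHS](@alternating_sum0 _ k.+1 G) => [|i j /andP[ij jk]].
  apply: eq_bigr => i _; rewrite linearZ /= poset_diff_in scaler_sumr.
  apply: eq_bigr => j _; rewrite scalerA -exprD /G !inord_val.
  by rewrite col_trans_comp ?chain_head_face.
rewrite /G addSn addnC exprS mulN1r scaleNr opprK; congr (_ *: tm _).
do 2!apply: val_inj => /=.
have ik := leq_ltn_trans ij jk.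
rewrite /chain_seq /= !inordK ?(ltnW ik) // ?(ltnW jk) //.
  exact: delete_delete.
exact: ltnW.
Qed.

Definition poset_complex : chain_complex R := ChainComplex poset_diff2.

End Chains.

Fact weaken_chain k (s : chain false k) : is_chain true (val s).
Proof.
have /andP[ssort stop] := valP s; rewrite /is_chain stop andbT.
by apply: sub_sorted ssort => x y; apply: lteifW.
Qed.

Definition weaken k (s : chain false k) : chain true k :=
  exist _ (val s) (weaken_chain s).

Definition weaken_in k (s : chain false k) (u : F (chain_head s)) :
  poset_obj true k := dsum_in (i := weaken s) u.

Fact weaken_in_linear k (s : chain false k) : linear (@weaken_in k s).
Proof. by move=> c u v; rewrite /weaken_in linearP. Qed.
HB.instance Definition _ k (s : chain false k) := GRing.isLinear.Build R
  (F (chain_head s)) (poset_obj true k) *:%R (@weaken_in k s)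
  (@weaken_in_linear k s).

Definition poset_incl_obj k :
    {linear poset_obj false k -> poset_obj true k} :=
  dsum_case (fun s : chain false k => @weaken_in k s).

Lemma poset_incl_in k (s : chain false k) (u : F (chain_head s)) :
  poset_incl_obj k (dsum_in (i := s) u) = dsum_in (i := weaken s) u.
Proof. exact: dsum_case_in. Qed.

Fact poset_incl_comm k u :
  poset_incl_obj k (poset_diff false k u) =
  poset_diff true k (poset_incl_obj k.+1 u).
Proof.
pose f : {linear poset_obj false k.+1 -> poset_obj true k} :=
  poset_incl_obj k \o poset_diff false k.
pose g : {linear poset_obj false k.+1 -> poset_obj true k} :=
  poset_diff true k \o poset_incl_obj k.+1.
suff: f =1 g by apply.
apply: dsum_linear_ext => s {}u; rewrite /f /g /=.
rewrite poset_diff_in poset_incl_in poset_diff_in linear_sum.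
apply: eq_bigr => i _; rewrite linearZ /= poset_incl_in; congr (_ *: _).
have faceE : face (weaken s) i = weaken (face s i) by do 2!apply: val_inj.
by rewrite faceE.
Qed.

(* The inclusion of the complex of strict sequences. *)
Definition poset_incl : chain_map (poset_complex false) (poset_complex true) :=
  @ChainMap R (poset_complex false) (poset_complex true)
    poset_incl_obj poset_incl_comm.

End PosetComplex.

Section CubeComplex.
Variables (R : pzRingType) (r : nat) (d : Order.disp_t).
Variables (B : finTBLatticeType d) (L : boolean_lattice r B).
Variable F : colouring R B.

(* rk x = r - n, without truncated subtraction. *)
Definition cube_cell (n : nat) : Type := {x : B | rk L x + n == r}%N.
HB.instance Definition _ n :=
  Finite.copy (cube_cell n) {x : B | rk L x + n == r}%N.
HB.instance Definition _ n :=
  SubType.copy (cube_cell n) {x : B | rk L x + n == r}%N.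

Definition cube_obj (n : nat) : lmodType R :=
  dsum (fun x : cube_cell n => F (val x)).

Definition cube_bdry n (x : cube_cell n.+1) (u : F (val x)) : cube_obj n :=
  \sum_(y : cube_cell n | covers (val x) (val y))
    cover_sign L R (val x) (val y) *:
      dsum_in (i := y) (col_trans F (val x) (val y) u).

Lemma cover_sign_comm x y (c : R) :
  GRing.comm (cover_sign L R x y) c.
Proof.
rewrite /cover_sign; case: new_atom => [l|]; first exact/commr_sym/commr_sign.
exact/commr_sym/commr1.
Qed.

Fact cube_bdry_linear n (x : cube_cell n.+1) : linear (@cube_bdry n x).
Proof.
move=> c u v; rewrite /cube_bdry scaler_sumr -big_split; apply: eq_bigr => y _.
by rewrite !linearP /= scalerDr !scalerA cover_sign_comm.
Qed.
HB.instance Definition _ n (x : cube_cell n.+1) := GRing.isLinear.Build R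
  (F (val x)) (cube_obj n) *:%R (@cube_bdry n x) (@cube_bdry_linear n x).

Definition cube_diff n : {linear cube_obj n.+1 -> cube_obj n} :=
  dsum_case (fun x : cube_cell n.+1 => @cube_bdry n x).

Lemma cube_diff_in n (x : cube_cell n.+1) (u : F (val x)) :
  cube_diff n (dsum_in (i := x) u) = cube_bdry u.
Proof. exact: dsum_case_in. Qed.

(* Over a fixed pair x < z at distance two, the signs of the two intermediate
   elements cancel. *)
Lemma cover_sign_square (x z : B) :
  \sum_(y | covers x y && covers y z)
    cover_sign L R x y * cover_sign L R y z = 0 :> R.
Proof.
case: (pickP (fun y => covers x y && covers y z)) => [y0|no]; last first.
  by rewrite big_pred0.
case/andP => /(coversP L)[l lx y0E] /(coversP L)[m my0 zE].
move: my0; rewrite y0E !inE negb_or => /andP[ml mx].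
have [y1 y1E] := atoms_below_surj L (m |: atoms_below L x).
have zE1 : atoms_below L z = l |: atoms_below L y1 by rewrite zE y0E y1E setUCA.
have my0 : m \notin atoms_below L y0 by rewrite y0E !inE negb_or ml.
have mx' : m \notin atoms_below L x by rewrite inE.
have ly1 : l \notin atoms_below L y1.
  by rewrite y1E in_setU1 negb_or eq_sym ml lx.
have xy0 : covers x y0 by apply/(coversP L); exists l.
have xy1 : covers x y1 by apply/(coversP L); exists m.
have y0z : covers y0 z by apply/(coversP L); exists m.
have y1z : covers y1 z by apply/(coversP L); exists l.
have y01 : y1 != y0.
  by apply: contraNneq my0 => <-; rewrite y1E !inE eqxx.
rewrite (bigD1 y0) ?xy0 //= (bigD1 y1) ?xy1 ?y1z ?y01 //= big1 => [|y]; last first.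
  case/andP=> /andP[/andP[/(coversP L)[p px yE] /(coversP L)[q qy zE2]] yy0 yy1].
  have : p \in atoms_below L z by rewrite zE2 yE !inE eqxx !orbT.
  rewrite zE y0E in_setU1 in_setU1 (negPf px) orbF => /orP[] /eqP pE.
    case/eqP: yy1; apply: (@atoms_below_inj _ _ _ L).
    by rewrite yE y1E pE.
  case/eqP: yy0; apply: (@atoms_below_inj _ _ _ L).
  by rewrite yE y0E pE.
rewrite addr0 (cover_signE R lx y0E) (cover_signE R my0 zE).
rewrite (cover_signE R mx' y1E) (cover_signE R ly1 zE1) -!exprD.
set c := fun k : 'I_r => #|[set i in atoms_below L x | (i < k)%N]|.
have cS (A : {set 'I_r}) (k : 'I_r) :
  #|[set i in A | (i < k)%N]| = (\sum_(i in A) (i < k))%N.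
  rewrite -sum1dep_card big_mkcondr; apply: eq_bigr => i _.
  by case: (_ < _)%N.
have cE (k p : 'I_r) (y : B) : p \notin atoms_below L x ->
  atoms_below L y = p |: atoms_below L x ->
  #|[set i in atoms_below L y | (i < k)%N]| = ((p < k) + c k)%N.
  move=> px yE; rewrite /c !cS yE big_setU1 //=.
rewrite (cE m l y0) // (cE l m y1) // -/(c l) -/(c m).
have -> : (c l + ((l < m) + c m) = (l < m) + (c l + c m))%N by rewrite addnCA.
have -> : (c m + ((m < l) + c l) = (m < l) + (c l + c m))%N
  by rewrite addnCA (addnC (c m)).
rewrite !exprD -mulrDl.
case: (ltngtP l m) ml => [lm|lm|/val_inj->] /=; last by rewrite eqxx.
  by rewrite expr1 expr0 addNr mul0r.
by rewrite expr1 expr0 addrN mul0r.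
Qed.

Fact cube_diff2 n u : cube_diff n (cube_diff n.+1 u) = 0.
Proof.
pose dd : {linear cube_obj n.+2 -> cube_obj n} := cube_diff n \o cube_diff n.+1.
suff: dd =1 (\0 : {linear cube_obj n.+2 -> cube_obj n}) by apply.
apply: dsum_linear_ext => x {}u /=; rewrite cube_diff_in linear_sum /=.
under eq_bigr do rewrite linearZ /= cube_diff_in scaler_sumr.
rewrite (exchange_big_dep xpredT) //=; apply: big1 => z _.
pose tm := dsum_in (M := fun x : cube_cell n => F (val x))
  (col_trans F (val x) (val z) u).
transitivity ((\sum_(y : cube_cell n.+1 |
    covers (val x) (val y) && covers (val y) (val z))
  cover_sign L R (val x) (val y) * cover_sign L R (val y) (val z)) *: tm).
  rewrite scaler_suml; apply: eq_bigr => y /andP[xy yz].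
  by rewrite scalerA col_trans_comp ?covers_le.
rewrite -[RHS](scale0r tm).
rewrite -[X in _ = X *: _](cover_sign_square (val x) (val z)); congr (_ *: _).
rewrite [RHS](bigID (fun y => rk L y + n.+1 == r)%N) /=.
rewrite [X in _ + X]big1 ?addr0; last first.
  move=> y /andP[/andP[xy _]].
  by rewrite (covers_rk L xy) addSnnS (valP x).
rewrite [RHS](reindex_omap (val : cube_cell n.+1 -> B) insub) /=; last first.
  by move=> y /andP[_ yr]; rewrite insubT.
apply: eq_bigl => y; rewrite valK eqxx andbT (valP y) andbT //.
Qed.

Definition cube_complex : chain_complex R := ChainComplex cube_diff2.

End CubeComplex.

Section Phi.
Variables (R : comPzRingType) (r : nat) (d : Order.disp_t).
Variables (B : finTBLatticeType d) (L : boolean_lattice r B).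
Variable F : colouring R B.

(* p : saturated n x stands for the saturated sequence x :: p from x to 1; when
   rk x = r - n every saturated sequence from x to 1 has n + 1 terms. *)
Definition saturated (n : nat) (x : B) : Type :=
  {p : n.-tuple B | path (@covers d B) x p && (last x p == \top%O)}.
HB.instance Definition _ n x := Finite.copy (saturated n x)
  {p : n.-tuple B | path (@covers d B) x p && (last x p == \top%O)}.

Lemma saturated_length (x : B) (p : seq B) :
  path (@covers d B) x p -> last x p = \top%O -> (rk L x + size p)%N = r.
Proof.
elim: p x => [|y p IH] x /=.
  by move=> _ ->; rewrite addn0 rk_atoms atoms_below_top cardsT card_ord.
by case/andP=> /(covers_rk L) xy py lp; rewrite -addSnnS -xy; apply: IH.
Qed.

Definition saturated_sign n x (p : saturated n x) : R :=
  \prod_(e <- pairmap (cover_sign L R) x (val p)) e.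

Fact trunc_size n x (p : saturated n x) : size (belast x (val p)) == n.
Proof. by rewrite size_belast size_tuple. Qed.

Lemma last_notin_belast (x : B) (s : seq B) :
  path <%O x s -> last x s \notin belast x s.
Proof.
elim: s x => //= y s IH x /andP[xy ys]; rewrite in_cons negb_or IH // andbT.
have yl : (y <= last y s)%O.
  have := order_path_min lt_trans ys => /allP sy.
  by have := mem_last y s; rewrite in_cons => /orP[/eqP->|/sy/ltW].
by rewrite gt_eqF // (lt_le_trans xy yl).
Qed.

Fact trunc_chain n x (p : saturated n x) : is_chain false (Tuple (trunc_size p)).
Proof.
have ltp : path <%O x (val p).
  by have /andP[xp _] := valP p; apply: sub_path xp => y z /andP[].
have /andP[_ /eqP lastp] := valP p; rewrite /is_chain /=; apply/andP; split.
  have : sorted <%O (rcons (belast x (val p)) (last x (val p))).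
    by rewrite -lastI.
  by rewrite -cats1 => /cat_sorted2[].
by have := last_notin_belast ltp; rewrite lastp.
Qed.

(* The sequence with its last term 1 removed. *)
Definition trunc n x (p : saturated n x) : chain B false n :=
  exist _ (Tuple (trunc_size p)) (trunc_chain p).

Lemma chain_head_trunc n x (p : saturated n x) : chain_head (trunc p) = x.
Proof.
have /andP[_ /eqP] := valP p.
rewrite /chain_head -[chain_seq (trunc p)]/(belast x (val p)).
by case: (tval (val p)).
Qed.

(* col_trans is the identity of F x here, by chain_head_trunc. *)
Definition phi_cell n (x : cube_cell L n) (u : F (val x)) : poset_obj F false n :=
  \sum_(p : saturated n (val x))
    saturated_sign p *: dsum_in (i := trunc p) (col_trans F _ _ u).

Fact phi_cell_linear n (x : cube_cell L n) : linear (@phi_cell n x).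
Proof.
move=> c u v; rewrite /phi_cell scaler_sumr -big_split; apply: eq_bigr => p _.
by rewrite !linearP.
Qed.
HB.instance Definition _ n (x : cube_cell L n) := GRing.isLinear.Build R
  (F (val x)) (poset_obj F false n) *:%R (@phi_cell n x) (@phi_cell_linear n x).

Definition phi n : {linear cube_obj L F n -> poset_obj F false n} :=
  dsum_case (fun x : cube_cell L n => @phi_cell n x).

End Phi.

Section Homologies.
Variables (R : comPzRingType) (r : nat) (d : Order.disp_t).
Variables (B : finTBLatticeType d) (L : boolean_lattice r B).
Variable F : colouring R B.

Definition coloured_complex : chain_complex R := poset_complex F true.
Definition strict_complex : chain_complex R := poset_complex F false.

Definition coloured_homology (n : nat) : lmodType R :=
  homology coloured_complex n.
Definition cube_homology (n : nat) : lmodType R :=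
  homology (cube_complex L F) n.

End Homologies.

(* Main.v *)
(* Both the cube complex K(F) and the complexes C(F), S(F) are exact functors of
   the colouring F, and phi is natural in F, so the acyclicity of its mapping cone
   can be proved by dimension shifting. Every F is a quotient of the colouring
   P : x |-> (+)_(y <= x) F(y), whose transition maps are inclusions; let N be the
   kernel. On P everything is contractible away from the summand y = 1 in degree
   0: for C and S prepend y to a chain, for K remove from a vertex a fixed atom
   not below y. Hence the cone of P is acyclic, and a cycle of degree n + 1 in the
   cone of F bounds as soon as one of degree n in the cone of N does. The argument
   is the same for C and S, so it also gives the isomorphism with the homology of
   S without comparing C and S directly. *)

From HB Require Import structures.
Require Import Defs.
From mathcomp Require Import all_boot all_order all_algebra.
From mathcomp Require Import boolp.

Set Implicit Arguments.
Unset Strict Implicit.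
Unset Printing Implicit Defensive.

Import Order.TTheory GRing.Theory.
Local Open Scope ring_scope.

(** * Mapping cones *)

Section Cone.
Variable R : pzRingType.

(* Exactness of the mapping cone C[-1] (+) D of f at degree n. *)
Definition cone_exact (C D : chain_complex R) (f : chain_map C D) (n : nat) :
    Prop :=
  match n with
  | 0 => forall c : D 0, exists k c', f 0 k - c = chain_diff D 0 c'
  | m.+1 => forall (k : C m) (c : D m.+1),
      is_cycle k -> f m k = chain_diff D m c ->
      exists k' c', chain_diff C m k' = k /\ f m.+1 k' - c = chain_diff D m.+1 c'
  end.

(** Surjectivity on H_n is exactness of the cone in degree n, injectivity is exactness in degree n +
    1. *)
Lemma cone_exact_quasi_isomorphism (C D : chain_complex R) (f : chain_map C D) :
  (forall n, cone_exact f n) -> quasi_isomorphism f.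
Proof.
move=> exf n.
(* Boolean equality is used so that [xchoose] can supply the inverse map at the end. *)
have surj h : exists k, homology_map f n k == h.
  rewrite -[h]lmod_quot_reprK; case: (lmod_quot_repr h) => c cc.
  have [k kc [c' fkc]] : exists2 k : C n, is_cycle k &
      exists c', f n k - c = chain_diff D n c'.
    case: n c cc (exf n) {h} => [|m] c cc exn; first by have [k] := exn c; exists k.
    (* A cycle c of D gives the cone cycle (0, c). *)
    have [||k [c' [dk fkc]]] := exn 0 c.
    - by case: (m) => [|p] //=; rewrite linear0.
    - by rewrite linear0 (eqP cc).
    by exists k; [apply/eqP | exists c'].
  exists (lmod_quot_pi (@is_boundary_submod _ C n) (exist _ k kc)).
  by rewrite homology_map_pi lmod_quot_eq; apply/asboolP; exists c'.
have inj : injective (homology_map f n).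
  apply: raddf_inj => h /=; rewrite -[h]lmod_quot_reprK homology_map_pi.
  rewrite -[RHS](linear0 (lmod_quot_pi (@is_boundary_submod _ D n))).
  move/eqP; rewrite lmod_quot_eq => /asboolP[v].
  rewrite subr0 /=; case: (lmod_quot_repr h) => k kc /= fk.
  (* If f(k) = d v, then (k, v) is a cone cycle; the first component of a filling shows that k
     bounds. *)
  have [k' [c' [dk' _]]] := exf n.+1 k v kc fk.
  apply/eqP; rewrite -[X in _ == X](linear0 (lmod_quot_pi (@is_boundary_submod _ C n))).
  by rewrite lmod_quot_eq subr0; apply/asboolP; exists k'.
exists (fun h => xchoose (surj h)) => h; last exact/eqP/(xchooseP (surj h)).
by apply: inj; apply/eqP/(xchooseP (surj _)).
Qed.

Definition short_exact (A B C : chain_complex R)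
    (i : chain_map A B) (p : chain_map B C) : Prop :=
  [/\ forall n, injective (i n),
      forall n u, p n u = 0 <-> exists v, i n v = u
    & forall n w, exists u, p n u = w].

(** The cones of [fA], [fB], [fC] form a short exact sequence. The diagram chase is the piece
    H_{n+1}(cone B) -> H_{n+1}(cone C) -> H_n(cone A) of its long exact sequence. *)
Lemma cone_exact_shift (CA CB CC DA DB DC : chain_complex R)
    (iC : chain_map CA CB) (pC : chain_map CB CC)
    (iD : chain_map DA DB) (pD : chain_map DB DC)
    (fA : chain_map CA DA) (fB : chain_map CB DB) (fC : chain_map CC DC) :
  short_exact iC pC -> short_exact iD pD ->
  (forall n u, fB n (iC n u) = iD n (fA n u)) ->
  (forall n u, fC n (pC n u) = pD n (fB n u)) ->
  forall n, cone_exact fA n -> cone_exact fB n.+1 -> cone_exact fC n.+1.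
Proof.
move=> [injC exC surC] [injD exD surD] fi fp n exA exB k c kc fk.
have [k1 pk1] := surC n k; have [c1 pc1] := surD n.+1 c.
(* (k1, c1) lifts (k, c); the failure of the lift to be a cycle comes from the cone of [fA]. *)
have [c2 ic2] : exists c2, iD n c2 = fB n k1 - chain_diff DB n c1.
  apply/exD; rewrite linearB -fp pk1 chain_map_comm pc1 fk subrr //.
(* That obstruction bounds in the cone of [fA]. For n = 0 it consists of c2 alone; otherwise it also
   has a component k2, with image d k1. *)
have [k3 [c3 [k3c fk3]]] : exists k3 c3,
    is_cycle (k1 - iC n k3) /\ fA n k3 - c2 = chain_diff DA n c3.
  case: n exA {exB} k c kc fk k1 pk1 c1 pc1 c2 ic2
    => [|n] exA k c kc fk k1 pk1 c1 pc1 c2 ic2.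
    by have [k3 [c3 E]] := exA c2; exists k3, c3.
  have [k2 ik2] : exists k2, iC n k2 = chain_diff CB n k1.
    by apply/exC; rewrite chain_map_comm pk1 (eqP kc).
  have [||k3 [c3 [dk3 fk3]]] := exA k2 c2.
  - case: n {exA k c kc fk pk1 c1 pc1 c2 ic2} k1 k2 ik2 => //= n k1 k2 ik2.
    by apply/eqP/injC; rewrite chain_map_comm ik2 chain_diff2 linear0.
  - apply: injD; rewrite -fi ik2 chain_map_comm chain_map_comm ic2 linearB.
    by rewrite chain_diff2 subr0.
  by exists k3, c3; split=> //=; rewrite linearB -chain_map_comm dk3 ik2 subrr.
(* Corrected by the image of (k3, c3), the lift is a cone cycle of [fB]; a filling of it projects to
   the one required. *)
have [|k' [c' [dk' fk']]] := exB (k1 - iC n k3) (c1 - iD n.+1 c3) k3c.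
  rewrite linearB fi linearB -chain_map_comm -fk3 [in RHS]linearB /= ic2.
  by rewrite opprB [RHS]addrA [X in _ = X - _]addrC subrK.
have pi0 (m : nat) u : pC m (iC m u) = 0 by apply/exC; exists u.
have pi0' (m : nat) u : pD m (iD m u) = 0 by apply/exD; exists u.
exists (pC n.+1 k'), (pD n.+2 c'); split.
  by rewrite -chain_map_comm dk' linearB pi0 pk1 subr0.
by rewrite fp -chain_map_comm -fk' [in RHS]linearB linearB pi0' pc1 subr0.
Qed.

Definition chain_map_comp_fun (C D E : chain_complex R) (g : chain_map D E)
  (f : chain_map C D) n : {linear C n -> E n} := g n \o f n.

Fact chain_map_comp_comm C D E (g : chain_map D E) (f : chain_map C D) n u :
  chain_map_comp_fun g f n (chain_diff C n u) =
  chain_diff E n (chain_map_comp_fun g f n.+1 u).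
Proof. by rewrite /chain_map_comp_fun /= !chain_map_comm. Qed.

Definition chain_map_comp C D E (g : chain_map D E) (f : chain_map C D) :
  chain_map C E := ChainMap (chain_map_comp_comm g f).

Lemma homology_map_comp C D E (g : chain_map D E) (f : chain_map C D) n :
  homology_map (chain_map_comp g f) n =1 homology_map g n \o homology_map f n.
Proof.
move=> h; rewrite -[h]lmod_quot_reprK /= !homology_map_pi.
by congr lmod_quot_pi; apply: val_inj.
Qed.

End Cone.

(** * Functoriality in the colouring *)

Section DirectSumMap.
Variables (R : pzRingType) (I : finType) (M N : I -> lmodType R).
Variable f : forall i, {linear M i -> N i}.

Definition dsum_map (u : dsum M) : dsum N := dsum_of (fun i => f i (u i)).

Lemma dsum_mapE u i : dsum_map u i = f i (u i).
Proof. exact: dsum_ofE. Qed.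

Fact dsum_map_linear : linear dsum_map.
Proof.
move=> a u v; apply: dsumP => i.
by rewrite dsumDE dsumZE !dsum_mapE dsumDE dsumZE linearP.
Qed.
HB.instance Definition _ :=
  GRing.isLinear.Build R (dsum M) (dsum N) *:%R dsum_map dsum_map_linear.

Lemma dsum_map_in i x : dsum_map (@dsum_in R I M i x) = dsum_in (f i x).
Proof.
apply: dsumP => j; rewrite dsum_mapE.
have [<-|ij] := eqVneq i j; first by rewrite !dsum_in_id.
by rewrite !dsum_in_neq // linear0.
Qed.

Lemma dsum_map_inj : (forall i, injective (f i)) -> injective dsum_map.
Proof.
move=> finj u v /(congr1 (fun w : dsum N => fun_of_fin w)) uv.
apply: dsumP => i; apply: (finj i).
by have := congr1 (fun w => w i) uv; rewrite !dsum_mapE.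
Qed.

Lemma dsum_map_surj :
  (forall i w, exists u, f i u = w) -> forall w, exists u, dsum_map u = w.
Proof.
move=> fsurj w.
have P i : exists u, f i u == w i by have [u <-] := fsurj i (w i); exists u.
exists (dsum_of (fun i => xchoose (P i))); apply: dsumP => i.
by rewrite ?dsum_mapE dsum_ofE; apply/eqP/(xchooseP (P i)).
Qed.

End DirectSumMap.

Lemma dsum_map_ker (R : pzRingType) (I : finType) (M N Q : I -> lmodType R)
    (f : forall i, {linear M i -> N i}) (g : forall i, {linear N i -> Q i}) :
  (forall i u, g i u = 0 <-> exists v, f i v = u) ->
  forall u, dsum_map g u = 0 <-> exists v, dsum_map f v = u.
Proof.
move=> ex u; split=> [gu0|[v <-]]; last first.
  by apply: dsumP => i; rewrite !dsum_mapE dsum0E; apply/(ex i); exists (v i).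
have P i : exists v, f i v == u i.
  have /(ex i)[v <-] : g i (u i) = 0.
    by rewrite -dsum_mapE gu0 dsum0E.
  by exists v.
exists (dsum_of (fun i => xchoose (P i))); apply: dsumP => i.
by rewrite ?dsum_mapE dsum_ofE; apply/eqP/(xchooseP (P i)).
Qed.

Section ColouringMorphism.
Variables (R : pzRingType) (d : Order.disp_t) (B : porderType d).

(** Naturality is asked of the total [col_trans], so that it rewrites without order side conditions;
    pairs without x <= y cost nothing, see [col_morphism_natP]. *)
Record col_morphism (F G : colouring R B) := ColMorphism {
  col_morphism_fun :> forall x, {linear F x -> G x};
  col_morphism_nat : forall x y u,
    col_morphism_fun y (col_trans F x y u) =
    col_trans G x y (col_morphism_fun x u)
}.

Definition col_short_exact (E F G : colouring R B)
    (i : col_morphism E F) (p : col_morphism F G) : Prop :=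
  [/\ forall x, injective (i x),
      forall x u, p x u = 0 <-> exists v, i x v = u
    & forall x w, exists u, p x u = w].

End ColouringMorphism.

Section Functoriality.
Variables (R : pzRingType) (r : nat) (d : Order.disp_t).
Variables (B : finTBLatticeType d) (L : boolean_lattice r B).

Section Maps.
Variables (F G : colouring R B) (h : col_morphism F G).

Definition cube_map_fun n : {linear cube_obj L F n -> cube_obj L G n} :=
  dsum_map (fun x : cube_cell L n => h (val x)).

Fact cube_map_comm n u :
  cube_map_fun n (cube_diff L F n u) = cube_diff L G n (cube_map_fun n.+1 u).
Proof.
pose f : {linear cube_obj L F n.+1 -> cube_obj L G n} :=
  cube_map_fun n \o cube_diff L F n.
pose g : {linear cube_obj L F n.+1 -> cube_obj L G n} :=
  cube_diff L G n \o cube_map_fun n.+1.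
suff: f =1 g by apply.
apply: dsum_linear_ext => x {}u; rewrite /f /g /= dsum_map_in !cube_diff_in.
rewrite linear_sum; apply: eq_bigr => y _.
by rewrite linearZ /= dsum_map_in col_morphism_nat.
Qed.

Definition cube_map : chain_map (cube_complex L F) (cube_complex L G) :=
  @ChainMap R (cube_complex L F) (cube_complex L G) cube_map_fun cube_map_comm.

Variable weak : bool.

Definition poset_map_fun n :
    {linear poset_obj F weak n -> poset_obj G weak n} :=
  dsum_map (fun s : chain B weak n => h (chain_head s)).

Fact poset_map_comm n u :
  poset_map_fun n (poset_diff F weak n u) =
  poset_diff G weak n (poset_map_fun n.+1 u).
Proof.
pose f : {linear poset_obj F weak n.+1 -> poset_obj G weak n} :=
  poset_map_fun n \o poset_diff F weak n.
pose g : {linear poset_obj F weak n.+1 -> poset_obj G weak n} :=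
  poset_diff G weak n \o poset_map_fun n.+1.
suff: f =1 g by apply.
apply: dsum_linear_ext => s {}u; rewrite /f /g /= dsum_map_in !poset_diff_in.
rewrite linear_sum; apply: eq_bigr => i _.
by rewrite linearZ /= dsum_map_in col_morphism_nat.
Qed.

Definition poset_map : chain_map (poset_complex F weak) (poset_complex G weak) :=
  @ChainMap R (poset_complex F weak) (poset_complex G weak)
    poset_map_fun poset_map_comm.

End Maps.

Variables (E F G : colouring R B) (i : col_morphism E F) (p : col_morphism F G).
Hypothesis exact_ip : col_short_exact i p.

(** In each degree the complex is a direct sum of values of the colouring over an index set
    independent of it, and direct sums are exact. *)
Lemma cube_map_exact : short_exact (cube_map i) (cube_map p).
Proof.
have [inji kerp surp] := exact_ip.
split=> n; first exact: dsum_map_inj.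
  exact: dsum_map_ker.
exact: dsum_map_surj.
Qed.

Lemma poset_map_exact weak : short_exact (poset_map i weak) (poset_map p weak).
Proof.
have [inji kerp surp] := exact_ip.
split=> n; first exact: dsum_map_inj.
  exact: dsum_map_ker.
exact: dsum_map_surj.
Qed.

End Functoriality.

(** * The chain map phi *)

Section Generators.
Variables (R : pzRingType) (d : Order.disp_t) (B : finTBLatticeType d).
Variables (F : colouring R B) (weak : bool).

(* The element u x_1 ... x_n of S_n or C_n, where u lives over some x <= x_1 and
   is transported to F(x_1); it is 0 unless s is a chain of length n. *)
Definition poset_gen n x (u : F x) (s : seq B) : poset_obj F weak n :=
  \sum_(c : chain B weak n | chain_seq c == s)
    dsum_in (i := c) (col_trans F x (chain_head c) u).

Lemma poset_gen_chain n x (u : F x) (c : chain B weak n) :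
  poset_gen n u (chain_seq c) =
  dsum_in (i := c) (col_trans F x (chain_head c) u).
Proof. by rewrite /poset_gen (big_pred1 c). Qed.

Lemma chain_of_seq n (s : seq B) : is_chain weak s -> size s = n ->
  exists c : chain B weak n, s = chain_seq c.
Proof.
move=> sc /eqP sn.
by exists (exist (fun t : n.-tuple B => is_chain weak t) (Tuple sn) sc).
Qed.

Lemma poset_gen0 n x (u : F x) (s : seq B) :
  ~~ is_chain weak s -> poset_gen n u s = 0.
Proof.
move=> sc; rewrite /poset_gen big_pred0 // => e.
by apply: contraNF sc => /eqP <-; apply: (valP e).
Qed.

Fact poset_gen_linear n x s : linear (fun u : F x => poset_gen n u s).
Proof.
move=> a u v; rewrite /poset_gen scaler_sumr -big_split /=.
by apply: eq_bigr => c _; rewrite !linearP.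
Qed.

Lemma poset_gen_trans n x y (u : F x) s :
  (x <= y)%O -> (y <= head \top s)%O ->
  poset_gen n (col_trans F x y u) s = poset_gen n u s.
Proof.
move=> xy ys; apply: eq_bigr => c /eqP cs.
by rewrite col_trans_comp // /chain_head cs.
Qed.

(** Since u stays in F(x) and [poset_gen] does the transport, the deletion of the first term needs
    no separate treatment. *)
Lemma poset_diff_gen n x (u : F x) s :
  is_chain weak s -> size s = n.+1 -> (x <= head \top s)%O ->
  poset_diff F weak n (poset_gen n.+1 u s) =
  \sum_(i < n.+1) (-1) ^+ i *: poset_gen n u (delete i s).
Proof.
move=> sc sn xs; have [c cs] := chain_of_seq sc sn.
rewrite cs poset_gen_chain poset_diff_in /chain_bdry.
apply: eq_bigr => i _; congr (_ *: _).
rewrite -[delete i _]/(chain_seq (face c i)) poset_gen_chain.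
rewrite col_trans_comp //; last exact: chain_head_face.
by rewrite /chain_head -cs.
Qed.

End Generators.

Lemma poset_map_gen (R : pzRingType) (d : Order.disp_t) (B : finTBLatticeType d)
    (F G : colouring R B) (h : col_morphism F G) weak n x (u : F x) s :
  poset_map h weak n (poset_gen weak n u s) = poset_gen weak n (h x u) s.
Proof.
rewrite /= /poset_map_fun /poset_gen linear_sum; apply: eq_bigr => c _.
by rewrite /= dsum_map_in col_morphism_nat.
Qed.

Lemma poset_incl_gen (R : pzRingType) (d : Order.disp_t)
    (B : finTBLatticeType d) (F : colouring R B) n x (u : F x) s :
  is_chain false s -> size s = n ->
  poset_incl F n (poset_gen false n u s) = poset_gen true n u s.
Proof.
move=> sc sn; have [c cs] := chain_of_seq sc sn.
rewrite {1}cs poset_gen_chain /= poset_incl_in.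
by rewrite cs -[chain_seq c]/(chain_seq (weaken c)) poset_gen_chain.
Qed.

(** * Signed sums over saturated sequences *)

Section SaturatedSum.
Variables (R : comPzRingType) (r : nat) (d : Order.disp_t).
Variables (B : finTBLatticeType d) (L : boolean_lattice r B).
Variable V : lmodType R.
Implicit Types (x y z : B) (g : seq B -> V).

(** Values in an arbitrary module and a function g of plain lists allow recursion on the first step
    of the sequence. *)
Definition saturated_sum n x g : V :=
  \sum_(p : saturated n x) saturated_sign R L p *: g (val p).

Lemma saturated_sumE n x g : saturated_sum n x g =
  \sum_(p : n.-tuple B | path (@covers d B) x p && (last x p == \top%O))
    (\prod_(e <- pairmap (cover_sign L R) x p) e) *: g p.
Proof.
rewrite /saturated_sum [RHS](reindex_omap (val : saturated n x -> n.-tuple B) insub) /=;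
  last by move=> p pP; rewrite insubT.
by apply: eq_bigl => p; rewrite valK eqxx andbT; symmetry; apply: (valP p).
Qed.

Lemma saturated_sum0 x g :
  saturated_sum 0 x g = if x == \top%O then g [::] else 0.
Proof.
rewrite saturated_sumE big_mkcond (big_pred1 [tuple]) => [|p] /=; last first.
  by rewrite tuple0; symmetry; apply/eqP.
by case: eqP => // _; rewrite big_nil scale1r.
Qed.

Lemma saturated_sumS n x g : saturated_sum n.+1 x g =
  \sum_(y | covers x y)
    cover_sign L R x y *: saturated_sum n y (fun p => g (y :: p)).
Proof.
transitivity (\sum_(y | covers x y)
  \sum_(p : n.-tuple B | path (@covers d B) y p && (last y p == \top%O))
    (\prod_(e <- pairmap (cover_sign L R) x (y :: p)) e) *: g (y :: p)).
  rewrite saturated_sumE pair_big_dep /=.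
  rewrite (reindex (fun yp : B * n.-tuple B => cons_tuple yp.1 yp.2)) /=.
    by apply: eq_bigl => -[y p]; rewrite andbA.
  exists (fun t : n.+1.-tuple B => (thead t, behead_tuple t)) => [[y p]|t] _ /=.
    by congr pair; apply: val_inj.
  by rewrite [RHS]tuple_eta; apply: val_inj.
apply: eq_bigr => y _; rewrite saturated_sumE scaler_sumr.
by apply: eq_bigr => p _; rewrite big_cons scalerA.
Qed.

Lemma eq_saturated_sum n x g1 g2 :
  (forall p, path (@covers d B) x p -> last x p = \top%O -> size p = n ->
     g1 p = g2 p) ->
  saturated_sum n x g1 = saturated_sum n x g2.
Proof.
move=> g12; apply: eq_bigr => p _; congr (_ *: _).
have /andP[xp /eqP lp] := valP p.
by apply: g12; rewrite ?size_tuple.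
Qed.

(* Each deletion of an inner term occurs with opposite signs for the two ways of
   filling the gap. *)
Lemma saturated_sum_delete n x g i : (i < n)%N ->
  saturated_sum n.+1 x (fun p => g (delete i p)) = 0.
Proof.
elim: i n x g => [|i IH] [|n] // x g ij; last first.
  rewrite saturated_sumS big1 // => y _.
  by rewrite (IH n y (fun p => g (y :: p))) ?scaler0.
rewrite saturated_sumS.
under eq_bigr do rewrite saturated_sumS scaler_sumr.
rewrite (exchange_big_dep xpredT) //=; apply: big1 => z _.
transitivity ((\sum_(y | covers x y && covers y z)
    cover_sign L R x y * cover_sign L R y z) *:
  saturated_sum n z (fun p => g (z :: p))).
  by rewrite scaler_suml; apply: eq_bigr => y _; rewrite scalerA.
by rewrite cover_sign_square scale0r.
Qed.

End SaturatedSum.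

Lemma saturated_sum_linear (R : comPzRingType) (r : nat) (d : Order.disp_t)
    (B : finTBLatticeType d) (L : boolean_lattice r B) (V W : lmodType R)
    (f : {linear V -> W}) n x g :
  f (saturated_sum L n x g) = saturated_sum L n x (fun p => f (g p)).
Proof. by rewrite linear_sum; apply: eq_bigr => p _; rewrite linearZ. Qed.

(** Position i of s is position i.+1 of x :: s; the bound keeps the deleted term distinct from the
    last one, which [belast] drops. *)
Lemma belast_delete (T : Type) i (x : T) (s : seq T) : (i.+1 < size s)%N ->
  belast x (delete i s) = delete i.+1 (belast x s).
Proof.
rewrite /delete; elim: s i x => //= y s IH [|i] x /= si.
  by case: s {IH} si => //= z s _; rewrite !drop0.
by rewrite IH.
Qed.

(** * Compatibility of phi with the differentials *)

Section Phi.
Variables (R : comPzRingType) (r : nat) (d : Order.disp_t).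
Variables (B : finTBLatticeType d) (L : boolean_lattice r B).

Lemma sum_cube_cell (V : zmodType) n (P : pred B) (f : B -> V) :
  \sum_(y : cube_cell L n | P (val y)) f (val y) =
  \sum_(y | P y && (rk L y + n == r)%N) f y.
Proof.
rewrite [RHS](reindex_omap (val : cube_cell L n -> B) insub) /=; last first.
  by move=> y /andP[_ yr]; rewrite insubT.
by apply: eq_bigl => y; rewrite valK eqxx andbT (valP y) andbT.
Qed.

(** A cover raises the rank by one, so it lies in the next cell type automatically. *)
Lemma sum_cube_cover (V : zmodType) n (x : cube_cell L n.+1) (f : B -> V) :
  \sum_(y : cube_cell L n | covers (val x) (val y)) f (val y) =
  \sum_(y | covers (val x) y) f y.
Proof.
rewrite (sum_cube_cell _ (covers (val x))); apply: eq_bigl => y.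
case xy: (covers _ _) => //=.
by rewrite (covers_rk L xy) addSnnS (valP x).
Qed.

Variable F : colouring R B.

Lemma phi_in n (x : cube_cell L n) (u : F (val x)) :
  phi L F n (dsum_in (i := x) u) =
  saturated_sum L n (val x) (fun p => poset_gen false n u (belast (val x) p)).
Proof.
transitivity (phi_cell u); first exact: dsum_case_in.
apply: eq_bigr => p _; congr (_ *: _).
by rewrite -[belast _ _]/(chain_seq (trunc p)) poset_gen_chain.
Qed.

Lemma belast_chain x p : path (@covers d B) x p -> last x p = \top%O ->
  is_chain false (belast x p).
Proof.
move=> xp lp.
exact: (trunc_chain (exist (fun q : (size p).-tuple B =>
  path (@covers d B) x q && (last x q == \top%O)) (in_tuple p)
  (introT andP (conj xp (introT eqP lp))))).
Qed.

Lemma head_belast_ge (x : B) p : (x <= head \top (belast x p))%O.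
Proof. by case: p => [|y p] /=; rewrite ?lex1. Qed.

(** In d(phi u), deleting the first term gives phi(d u), and deleting any later term gives 0 by
    [saturated_sum_delete]. *)
Fact phi_comm n u :
  phi L F n (cube_diff L F n u) = poset_diff F false n (phi L F n.+1 u).
Proof.
pose f : {linear cube_obj L F n.+1 -> poset_obj F false n} :=
  phi L F n \o cube_diff L F n.
pose g : {linear cube_obj L F n.+1 -> poset_obj F false n} :=
  poset_diff F false n \o phi L F n.+1.
suff: f =1 g by apply.
apply: dsum_linear_ext => x {}u; rewrite /f /g /= cube_diff_in phi_in.
rewrite saturated_sum_linear linear_sum /=.
under eq_bigr do rewrite linearZ /= phi_in.
(* Splitting off the first cover x < y of a saturated sequence turns its sign into the sign in the
   cube differential. *)
transitivity (saturated_sum L n.+1 (val x) (fun p =>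
    poset_gen false n u (delete 0 (belast (val x) p)))).
  rewrite saturated_sumS -sum_cube_cover; apply: eq_bigr => y xy.
  congr (_ *: _); apply: eq_saturated_sum => p _ _ _.
  rewrite /delete /= drop0.
  exact: poset_gen_trans (covers_le xy) (head_belast_ge _ _).
transitivity (\sum_(i < n.+1) (-1) ^+ i *: saturated_sum L n.+1 (val x)
   (fun p => poset_gen false n u (delete i (belast (val x) p)))).
  (* For i > 0 the deleted term lies strictly between the ends x and 1 of the sequence. *)
  rewrite big_ord_recl expr0 scale1r [X in _ = _ + X]big1 ?addr0 // => i _.
  rewrite -[X in _ *: X = _](_ : saturated_sum L n.+1 (val x) (fun p =>
    poset_gen false n u (belast (val x) (delete i p))) = _).
    by rewrite (@saturated_sum_delete _ _ _ _ _ _ _ _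
      (fun p => poset_gen false n u (belast (val x) p))) // scaler0.
  apply: eq_saturated_sum => p _ _ sp; congr (poset_gen false n u _).
  by rewrite lift0 belast_delete // sp ltnS.
rewrite /saturated_sum; under eq_bigr do rewrite scaler_sumr.
rewrite exchange_big /=; apply: eq_bigr => p _.
have /andP[xp /eqP lp] := valP p.
rewrite poset_diff_gen ?belast_chain ?head_belast_ge ?size_belast ?size_tuple //.
rewrite scaler_sumr; apply: eq_bigr => i _.
by rewrite !scalerA mulrC.
Qed.

Definition phi_map : chain_map (cube_complex L F) (strict_complex F) :=
  @ChainMap R (cube_complex L F) (strict_complex F) (phi L F) phi_comm.

End Phi.

(** * The map phi into either poset complex, and its cone in degree 0 *)

Section AugmentedPhi.
Variables (R : comPzRingType) (r : nat) (d : Order.disp_t).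
Variables (B : finTBLatticeType d) (L : boolean_lattice r B).

(** The two values of [weak] make both claims of the theorem instances of one exactness
    statement. *)
Definition phi_into (F : colouring R B) (weak : bool) :
    chain_map (cube_complex L F) (poset_complex F weak) :=
  if weak is true then chain_map_comp (poset_incl F) (phi_map L F)
  else phi_map L F.

Lemma phi_into_in (F : colouring R B) weak n (x : cube_cell L n) (u : F (val x)) :
  phi_into F weak n (dsum_in (i := x) u) =
  saturated_sum L n (val x) (fun p => poset_gen weak n u (belast (val x) p)).
Proof.
case: weak; last exact: phi_in.
transitivity (poset_incl F n (phi L F n (dsum_in (i := x) u))) => //.
rewrite phi_in saturated_sum_linear; apply: eq_saturated_sum => p xp lp sp.
by rewrite poset_incl_gen ?size_belast ?belast_chain.
Qed.

Lemma phi_into_nat (F G : colouring R B) (h : col_morphism F G) weak n u :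
  phi_into G weak n (cube_map L h n u) = poset_map h weak n (phi_into F weak n u).
Proof.
pose f : {linear cube_obj L F n -> poset_obj G weak n} :=
  phi_into G weak n \o cube_map L h n.
pose g : {linear cube_obj L F n -> poset_obj G weak n} :=
  poset_map h weak n \o phi_into F weak n.
suff: f =1 g by apply.
apply: dsum_linear_ext => x {}u; rewrite /f /g.
transitivity (phi_into G weak n (dsum_in (i := x) (h _ u))).
  by congr (phi_into G weak n _); apply: dsum_map_in.
transitivity (poset_map h weak n (phi_into F weak n (dsum_in (i := x) u))) => //.
rewrite !phi_into_in saturated_sum_linear; apply: eq_saturated_sum => p _ _ _.
by rewrite poset_map_gen.
Qed.

Lemma cube_cell0 (x : cube_cell L 0) : val x = \top%O.
Proof.
apply: (@atoms_below_inj _ _ _ L); apply/eqP.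
rewrite atoms_below_top eqEcard subsetT /= cardsT card_ord -rk_atoms.
by have /eqP := valP x; rewrite addn0 => ->.
Qed.

Lemma phi_into_in0 (F : colouring R B) weak (x : cube_cell L 0) (u : F (val x)) :
  phi_into F weak 0 (dsum_in (i := x) u) = poset_gen weak 0 u [::].
Proof. by rewrite phi_into_in saturated_sum0 (introT eqP (cube_cell0 x)). Qed.

Fact top_cube_cell_subproof : (rk L \top%O + 0 == r)%N.
Proof. by rewrite addn0 rk_atoms atoms_below_top cardsT card_ord. Qed.

Definition top_cube_cell : cube_cell L 0 := exist _ \top%O top_cube_cell_subproof.

(** Base of the induction: in degree 0 both complexes are F(1) and phi is the identity, so it is
    onto without a boundary correction. *)
Lemma cone_exact_phi_into0 (F : colouring R B) weak : cone_exact (phi_into F weak) 0.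
Proof.
move=> c; pose e : chain B weak 0 :=
  exist (fun t : 0.-tuple B => is_chain weak t) [tuple] isT.
exists (dsum_in (i := top_cube_cell) (c e)), 0.
rewrite linear0 phi_into_in0 -[[::]]/(chain_seq e) poset_gen_chain.
rewrite [c in _ - c](dsum_decomp c) (big_pred1 e) => [|s] /=; last first.
  by symmetry; apply/eqP/val_inj; rewrite /= (tuple0 (val s)).
by rewrite col_trans_id subrr.
Qed.

End AugmentedPhi.

(** * Submodules, and colourings by a monotone family of submodules *)

Section Submodules.
Variables (R : pzRingType) (V : lmodType R).

(** The closure proof is an argument of the type, so that instance inference finds the module
    structure. *)
Definition submod (W : {pred V}) (WP : subsemimod_closed W) : Type :=
  {v : V | submod_pred WP v}.
HB.instance Definition _ W WP := SubChoice.on (@submod W WP).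
HB.instance Definition _ W WP := [SubChoice_isSubLmodule of @submod W WP by <:].

Variables (W1 W2 : {pred V}).
Variables (WP1 : subsemimod_closed W1) (WP2 : subsemimod_closed W2).
Hypothesis W12 : {subset W1 <= W2}.

Definition submod_incl (v : submod WP1) : submod WP2 :=
  exist _ (val v) (W12 (valP v)).

Fact submod_incl_linear : linear submod_incl.
Proof. by move=> a u v; apply: val_inj. Qed.
HB.instance Definition _ := GRing.isLinear.Build R (submod WP1) (submod WP2)
  *:%R submod_incl submod_incl_linear.

End Submodules.

Section SubColouring.
Variables (R : pzRingType) (d : Order.disp_t) (B : porderType d).
Variables (V : lmodType R) (W : B -> {pred V}).
Hypothesis WP : forall x, subsemimod_closed (W x).
Hypothesis Wmono : forall x y, (x <= y)%O -> {subset W x <= W y}.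

(** Kept transparent: elements of [sub_colouring x] are later viewed as elements of [submod (WP x)]
    by conversion. *)
Definition sub_colouring : colouring R B.
Proof.
refine (@Colouring R d B (fun x => submod (WP x))
  (fun x y xy => submod_incl (WP y) (Wmono xy)) _ _).
- by move=> x xx u; apply: val_inj.
- by move=> x y z xy yz xz u; apply: val_inj.
Defined.

Lemma val_col_trans x y (u : sub_colouring x) : (x <= y)%O ->
  val (col_trans sub_colouring x y u : submod (WP y)) =
  val (u : submod (WP x)).
Proof. by move=> xy; rewrite (col_transE xy). Qed.

End SubColouring.

(** * The resolution N -> P -> F *)

Section FreeResolution.
Variables (R : pzRingType) (d : Order.disp_t) (B : finPOrderType d).

Lemma col_trans_nle (F : colouring R B) x y u :
  ~~ (x <= y)%O -> col_trans F x y u = 0.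
Proof.
move=> xy; rewrite /col_trans; case: {-}_ / idP => // xy'.
by rewrite xy' in xy.
Qed.

Lemma col_morphism_natP (F G : colouring R B) (h : forall x, {linear F x -> G x}) :
  (forall x y u, (x <= y)%O ->
    h y (col_trans F x y u) = col_trans G x y (h x u)) ->
  forall x y u, h y (col_trans F x y u) = col_trans G x y (h x u).
Proof.
move=> hn x y u; have [/hn//|xy] := boolP (x <= y)%O.
by rewrite !col_trans_nle ?linear0.
Qed.

Variable F : colouring R B.

Local Notation V := (dsum (fun x : B => F x)).

(** P(x) is cut out of one ambient sum V by a support condition, which makes the transition maps
    plain inclusions. *)
Definition below (x : B) : {pred V} :=
  fun u => [forall y, (y <= x)%O || (u y == 0)].

Lemma belowP x (u : V) : reflect (forall y, ~~ (y <= x)%O -> u y = 0) (u \in below x).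
Proof.
apply: (iffP forallP) => [ux y yx|ux y].
  by have := ux y; rewrite (negPf yx) => /eqP.
by case: (boolP (y <= x)%O) => //= /ux ->.
Qed.

Fact below_submod x : subsemimod_closed (below x).
Proof.
split; first split; first by apply/belowP => y _; rewrite dsum0E.
  by move=> u v /belowP ux /belowP vx; apply/belowP => y yx;
     rewrite dsumDE ux ?vx ?addr0.
by move=> a u /belowP ux; apply/belowP => y yx; rewrite dsumZE ux ?scaler0.
Qed.

Fact below_mono x y : (x <= y)%O -> {subset below x <= below y}.
Proof.
move=> xy u /belowP ux; apply/belowP => z zy; apply: ux.
by apply: contra zy => /le_trans; apply.
Qed.

Definition free_col : colouring R B := sub_colouring below_submod below_mono.

Definition col_eval x : {linear V -> F x} := dsum_case (fun y => col_trans F y x).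

(** The support condition excludes indices z <= y with z not below x, which would contribute to the
    left side only. *)
Lemma col_eval_trans x y (u : V) : (x <= y)%O -> u \in below x ->
  col_eval y u = col_trans F x y (col_eval x u).
Proof.
move=> xy /belowP ux; rewrite linear_sum; apply: eq_bigr => z _ /=.
have [zx|/ux ->] := boolP (z <= x)%O; first by rewrite col_trans_comp.
by rewrite !linear0.
Qed.

(** The kernel N(x) of P(x) -> F(x), again inside V. *)
Definition syzygy (x : B) : {pred V} :=
  fun u => (u \in below x) && (col_eval x u == 0).

Fact syzygy_submod x : subsemimod_closed (syzygy x).
Proof.
have [[b0 bD] bZ] := below_submod x.
split; first split; first by apply/andP; rewrite b0 linear0.
- move=> u v /andP[ux /eqP u0] /andP[vx /eqP v0].
  by apply/andP; rewrite bD // linearD u0 v0 addr0.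
- move=> a u /andP[ux /eqP u0].
  by apply/andP; rewrite bZ // linearZ /= u0 scaler0.
Qed.

Fact syzygy_mono x y : (x <= y)%O -> {subset syzygy x <= syzygy y}.
Proof.
move=> xy u /andP[ux /eqP u0]; apply/andP; split; first exact: below_mono ux.
by rewrite (col_eval_trans xy) // u0 linear0.
Qed.

Definition syzygy_col : colouring R B := sub_colouring syzygy_submod syzygy_mono.

Fact syzygy_below x : {subset syzygy x <= below x}.
Proof. by move=> u /andP[]. Qed.

Definition syzygy_incl_fun x : {linear syzygy_col x -> free_col x} :=
  submod_incl (WP1 := syzygy_submod x) (below_submod x) (@syzygy_below x).

Fact syzygy_incl_nat x y u :
  syzygy_incl_fun y (col_trans syzygy_col x y u) =
  col_trans free_col x y (syzygy_incl_fun x u).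
Proof.
move: x y u; apply: col_morphism_natP => x y u xy; apply: val_inj => /=.
by rewrite !val_col_trans.
Qed.

Definition syzygy_incl : col_morphism syzygy_col free_col :=
  ColMorphism syzygy_incl_nat.

Definition free_coef x y (u : free_col x) : F y :=
  (val (u : submod (below_submod x)) : V) y.

Fact free_coef_linear x y : linear (@free_coef x y).
Proof. by move=> a u v; rewrite /free_coef linearP dsumDE dsumZE. Qed.
HB.instance Definition _ x y := GRing.isLinear.Build R (free_col x) (F y)
  *:%R (@free_coef x y) (@free_coef_linear x y).

Lemma free_coef_nle x y (u : free_col x) : ~~ (y <= x)%O -> free_coef y u = 0.
Proof. by move=> yx; have /belowP := valP (u : submod (below_submod x)); apply. Qed.

Lemma free_coef_inj x (u v : free_col x) :
  (forall y, (y <= x)%O -> free_coef y u = free_coef y v) -> u = v.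
Proof.
move=> uv; apply: val_inj; apply: dsumP => y.
have [/uv//|yx] := boolP (y <= x)%O.
by have := free_coef_nle u yx; rewrite -(free_coef_nle v yx).
Qed.

Lemma free_coef_trans x x' y (u : free_col x) : (x <= x')%O ->
  free_coef y (col_trans free_col x x' u) = free_coef y u.
Proof. by move=> xx'; rewrite /free_coef val_col_trans. Qed.

Definition free_eval_fun x (u : free_col x) : F x :=
  col_eval x (val (u : submod (below_submod x))).

Fact free_eval_linear x : linear (@free_eval_fun x).
Proof. by move=> a u v; rewrite /free_eval_fun !linearP. Qed.
HB.instance Definition _ x := GRing.isLinear.Build R (free_col x) (F x)
  *:%R (@free_eval_fun x) (@free_eval_linear x).

Fact free_eval_nat x y (u : free_col x) :
  free_eval_fun (col_trans free_col x y u) = col_trans F x y (free_eval_fun u).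
Proof.
apply: (@col_morphism_natP free_col F (fun x => @free_eval_fun x)) => {}x {}y {}u xy.
rewrite /= /free_eval_fun val_col_trans //; apply: col_eval_trans => //.
exact: (valP (u : submod (below_submod x))).
Qed.

Definition free_eval : col_morphism free_col F :=
  @ColMorphism _ _ _ free_col F (fun x => @free_eval_fun x) free_eval_nat.

Fact free_in_subproof y (a : F y) : dsum_in a \in below y.
Proof.
apply/belowP => z zy; rewrite dsum_in_neq //.
by apply: contraNneq zy => ->.
Qed.

Definition free_in y (a : F y) : free_col y :=
  (exist _ (dsum_in a) (free_in_subproof a) : submod (below_submod y)).

Fact free_in_linear y : linear (@free_in y).
Proof. by move=> a u v; apply: val_inj; rewrite /= linearP. Qed.
HB.instance Definition _ y := GRing.isLinear.Build R (F y) (free_col y)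
  *:%R (@free_in y) (@free_in_linear y).

Lemma free_resolution : col_short_exact syzygy_incl free_eval.
Proof.
split=> x.
- by move=> u v /(congr1 val) uv; apply: val_inj.
- move=> u; split=> [u0|[v <-]]; last first.
    by have /andP[_ /eqP] := valP (v : submod (syzygy_submod x)).
  have us : val (u : submod (below_submod x)) \in syzygy x.
    apply/andP; split; first exact: (valP (u : submod (below_submod x))).
    exact/eqP.
  by exists (exist (submod_pred (syzygy_submod x)) _ us); apply: val_inj.
- move=> w; exists (free_in w).
  by rewrite /= /free_eval_fun /= dsum_case_in col_trans_id.
Qed.

(** * Linear maps out of direct sums of values of the free colouring *)

Section Extension.
Variables (I : finType) (lab : I -> B).

Local Notation D := (dsum (fun i => free_col (lab i))).

(** With [lab] the head of a chain or the vertex of a cell, D is a chain module of P; these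
    elements, for y <= lab i, generate it. *)
Definition free_gen i y (a : F y) : D :=
  dsum_in (i := i) (col_trans free_col y (lab i) (free_in a)).

Lemma free_coef_gen i y (a : F y) j z : (y <= lab i)%O ->
  free_coef z (free_gen i a j) =
  if (i == j) then dsum_in (M := fun x : B => F x) a z else 0.
Proof.
move=> yi; rewrite /free_gen; case: eqP => [<-|/eqP ij].
  by rewrite dsum_in_id free_coef_trans.
by rewrite dsum_in_neq // linear0.
Qed.

Lemma free_decomp (c : D) :
  c = \sum_i \sum_(y | (y <= lab i)%O) free_gen i (free_coef y (c i)).
Proof.
rewrite [LHS]dsum_decomp; apply: eq_bigr => i _.
rewrite /free_gen -linear_sum; congr dsum_in.
apply: free_coef_inj => z zi; rewrite linear_sum (bigD1 z) //= big1 ?addr0.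
  by rewrite free_coef_trans // /free_coef /= dsum_in_id.
move=> y /andP[yi yz]; rewrite free_coef_trans //.
by rewrite [LHS]dsum_in_neq.
Qed.

Lemma free_linear_ext (W : lmodType R) (f g : {linear D -> W}) :
  (forall i y (a : F y), (y <= lab i)%O ->
    f (free_gen i a) = g (free_gen i a)) -> f =1 g.
Proof.
move=> fg c; rewrite (free_decomp c) !linear_sum; apply: eq_bigr => i _.
by rewrite !linear_sum; apply: eq_bigr => y yi; apply: fg.
Qed.

Variables (W : lmodType R) (g : forall (i : I) (y : B), {linear F y -> W}).

(** The inner sum may run over all y, because the coefficients with y not below lab i vanish
    ([free_coef_nle]). *)
Definition free_ext (c : D) : W := \sum_i \sum_y g i y (free_coef y (c i)).

Fact free_ext_linear : linear free_ext.
Proof.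
move=> a u v; rewrite /free_ext scaler_sumr -big_split; apply: eq_bigr => i _.
rewrite scaler_sumr -big_split; apply: eq_bigr => y _ /=.
by rewrite dsumDE dsumZE !linearP.
Qed.
HB.instance Definition _ :=
  GRing.isLinear.Build R D W *:%R free_ext free_ext_linear.

Lemma free_ext_gen i y (a : F y) : (y <= lab i)%O ->
  free_ext (free_gen i a) = g i y a.
Proof.
move=> yi; rewrite /free_ext (bigD1 i) //= [X in _ + X]big1 ?addr0 => [|j ji].
  rewrite (bigD1 y) //= big1 ?addr0 => [|z zy].
    by rewrite free_coef_gen // eqxx dsum_in_id.
  by rewrite free_coef_gen // eqxx dsum_in_neq ?linear0 // eq_sym.
by apply: big1 => z _; rewrite free_coef_gen // eq_sym (negPf ji) linear0.
Qed.

End Extension.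
End FreeResolution.

(** * Contractions for the free colouring *)

Section FreePosetHomotopy.
Variables (R : pzRingType) (d : Order.disp_t) (B : finTBLatticeType d).
Variables (F : colouring R B) (weak : bool).

Local Notation P := (free_col F).

(** For y below the head, this is 0 by the convention of [poset_gen] when y = 1, or when chains are
    strict and y is already the first term. *)
Definition poset_prepend n (c : chain B weak n) y (a : F y) :
    poset_obj P weak n.+1 :=
  poset_gen weak n.+1 (free_in a) (y :: chain_seq c).

Fact poset_prepend_linear n c y : linear (@poset_prepend n c y).
Proof. by move=> k u v; rewrite /poset_prepend linearP poset_gen_linear. Qed.
HB.instance Definition _ n c y := GRing.isLinear.Build R (F y)
  (poset_obj P weak n.+1) *:%R (@poset_prepend n c y)
  (@poset_prepend_linear n c y).

Definition poset_homotopy n :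
    {linear poset_obj P weak n -> poset_obj P weak n.+1} :=
  free_ext (fun (c : chain B weak n) y => @poset_prepend n c y).

Lemma poset_homotopy_gen n y (a : F y) s :
  is_chain weak s -> size s = n -> (y <= head \top s)%O ->
  poset_homotopy n (poset_gen weak n (free_in a) s) =
  poset_gen weak n.+1 (free_in a) (y :: s).
Proof.
move=> sc sn ys; have [c cs] := chain_of_seq sc sn.
rewrite cs poset_gen_chain; apply: (free_ext_gen (lab := @chain_head _ B weak n)).
by rewrite /chain_head -cs.
Qed.

Lemma delete0_cons (T : Type) (x : T) s : delete 0 (x :: s) = s.
Proof. by rewrite /delete /= drop0. Qed.

Lemma is_chain_delete i (s : seq B) : is_chain weak s -> is_chain weak (delete i s).
Proof. exact/is_chain_subseq/delete_subseq. Qed.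

Lemma head_delete_ge i (s : seq B) : is_chain weak s ->
  (head \top s <= head \top (delete i s))%O.
Proof.
case: s => [|x s] /andP[] //=; rewrite /delete; case: i => [|i] /=; rewrite ?lexx //.
by case: s => [|y s] /=; rewrite ?lex1 // => /andP[/lteifW].
Qed.

(** Among the faces of y :: s, deleting y gives s, and the others cancel against y prepended to the
    faces of s. If y :: s is not a chain, the term h(d s) alone gives s. *)
Lemma poset_homotopyP n (u : poset_obj P weak n.+1) :
  poset_diff P weak n.+1 (poset_homotopy n.+1 u) +
  poset_homotopy n (poset_diff P weak n u) = u.
Proof.
pose f : {linear poset_obj P weak n.+1 -> poset_obj P weak n.+1} :=
  (poset_diff P weak n.+1 \o poset_homotopy n.+1) \+
  (poset_homotopy n \o poset_diff P weak n).
pose g : {linear poset_obj P weak n.+1 -> poset_obj P weak n.+1} := idfun.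
suff: f =1 g by apply.
apply: free_linear_ext => c y a yc; rewrite /free_gen -poset_gen_chain.
set v := poset_gen _ _ _ _.
rewrite -[f v]/(poset_diff P weak n.+1 (poset_homotopy n.+1 v) +
  poset_homotopy n (poset_diff P weak n v)) -[g v]/v {}/v.
set s := chain_seq c; have sc : is_chain weak s by apply: (valP c).
have sn : size s = n.+1 by rewrite size_tuple.
have {}yc : (y <= head \top s)%O := yc.
rewrite poset_homotopy_gen // [X in poset_homotopy n X]poset_diff_gen //.
rewrite [X in _ + X]linear_sum.
have -> : \sum_(i < n.+1) poset_homotopy n
      ((-1) ^+ i *: poset_gen weak n (free_in a) (delete i s)) =
    \sum_(i < n.+1) (-1) ^+ i *:
      poset_gen weak n.+1 (free_in a) (y :: delete i s).
  apply: eq_bigr => i _; rewrite linearZ /= poset_homotopy_gen //.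
  - exact: is_chain_delete.
  - by rewrite size_delete sn.
  - exact: le_trans yc (head_delete_ge _ _).
have [ysc|ysc] := boolP (is_chain weak (y :: s)).
  rewrite poset_diff_gen /= ?sn // big_ord_recl expr0 scale1r delete0_cons.
  rewrite -addrA -big_split big1 ?addr0 // => i _.
  by rewrite lift0 /= exprS mulN1r scaleNr addNr.
(* In positive degree y <= x_1 < 1, so prepending fails only for strict chains with y = x_1. *)
rewrite poset_gen0 // linear0 add0r.
case: s sc sn yc ysc => //= x s /andP[/= sx]; rewrite inE negb_or.
move=> /andP[xT sT] [sn] yx;
have yT : y != \top%O by rewrite -ltx1 (le_lt_trans yx) ?ltx1 // eq_sym.
rewrite /is_chain /= sx !inE !negb_or eq_sym yT xT sT !andbT => yxs.
have [wF xE] : weak = false /\ x = y.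
  case: (weak) yxs => /=; first by rewrite yx.
  by rewrite lt_neqAle yx andbT negbK => /eqP.
subst x.
(* Deleting x_1 and prepending y = x_1 restores the chain; every other face still begins with x_1,
   so prepending repeats it and gives 0. *)
rewrite big_ord_recl expr0 scale1r delete0_cons big1 ?addr0 // => i _.
rewrite poset_gen0 ?scaler0 // /is_chain lift0 /= wF.
by rewrite /= ltxx.
Qed.

Lemma free_poset_exact n (u : poset_obj P weak n.+1) :
  poset_diff P weak n u = 0 -> exists v, u = poset_diff P weak n.+1 v.
Proof.
move=> du; exists (poset_homotopy n.+1 u).
by rewrite -{1}[u]poset_homotopyP du linear0 addr0.
Qed.

Definition empty_chain : chain B weak 0 :=
  exist (fun t : 0.-tuple B => is_chain weak t) [tuple] isT.

(** A one-term chain x has x < 1, so P(x) has no component with label 1 and neither has its image.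
    This coefficient is the obstruction to bounding in degree 0. *)
Lemma free_coef_poset_diff0 (u : poset_obj P weak 1) :
  free_coef \top%O (poset_diff P weak 0 u empty_chain : P \top%O) = 0.
Proof.
rewrite (free_decomp u) linear_sum dsum_sumE linear_sum big1 // => c _.
rewrite linear_sum dsum_sumE linear_sum big1 // => y yc.
rewrite /free_gen poset_diff_in /chain_bdry big_ord1 expr0 scale1r.
have -> : face c ord0 = empty_chain by apply: val_inj; exact: tuple0.
rewrite dsum_in_id /= !free_coef_trans ?lex1 // /free_coef /= dsum_in_neq //.
apply: contraTneq yc => ->; rewrite le1x.
move: (valP c); rewrite /chain_head /chain_seq.
case: (val c) => [[|x s] // sz] /= /andP[_].
by rewrite inE negb_or eq_sym => /andP[].
Qed.

End FreePosetHomotopy.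

(** * Contraction of the cube complex, with vertices encoded as sets of atoms *)

Section FreeCubeHomotopy.
Variables (R : comPzRingType) (r : nat) (d : Order.disp_t).
Variables (B : finTBLatticeType d) (L : boolean_lattice r B).

Definition atoms_join (I : {set 'I_r}) : B := (\join_(i in I) bl_atom L i)%O.

Lemma atoms_below_atoms_join I : atoms_below L (atoms_join I) = I.
Proof. by symmetry; apply/join_atomsE. Qed.

Lemma atoms_join_atoms_below x : atoms_join (atoms_below L x) = x.
Proof. exact/join_atomsE. Qed.

Lemma le_atoms_join x I : (x <= atoms_join I)%O = (atoms_below L x \subset I).
Proof. by rewrite (atoms_below_le L) atoms_below_atoms_join. Qed.

Lemma sum_covers_atoms_join (V : nmodType) I (f : B -> V) :
  \sum_(z | covers (atoms_join I) z) f z =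
  \sum_(m | m \notin I) f (atoms_join (m |: I)).
Proof.
(* The partial inverse recovers m as the only atom below z outside I. *)
rewrite (reindex_omap (fun m => atoms_join (m |: I))
  (fun z => [pick l in atoms_below L z :\: I])) /=; last first.
  move=> z /(coversP L)[l]; rewrite atoms_below_atoms_join => lI zE.
  have -> : atoms_below L z :\: I = [set l].
    by rewrite zE setDUl setDv setU0; apply/setDidPl; rewrite disjoints1.
  case: pickP => [m /set1P->|/(_ l)] /=; last by rewrite set11.
  by rewrite -zE atoms_join_atoms_below.
apply: eq_bigl => m; rewrite atoms_below_atoms_join.
apply/andP/idP => [[_ /eqP]|mI].
  by case: pickP => // l; rewrite !inE => /andP[lI _] [<-].
split; first by apply/(coversP L); exists m; rewrite !atoms_below_atoms_join.
have -> : (m |: I) :\: I = [set m].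
  by rewrite setDUl setDv setU0; apply/setDidPl; rewrite disjoints1.
by case: pickP => [l /set1P->|/(_ m)] //; rewrite set11.
Qed.

(** The exponent of the sign of the cover from I to m |: I; m is not counted, so either set gives
    the same number. *)
Definition atoms_before (I : {set 'I_r}) (m : 'I_r) : nat :=
  #|[set i in I | (i < m)%N]|.

Lemma atoms_beforeU1 (I : {set 'I_r}) p m :
  p \notin I -> atoms_before (p |: I) m = ((p < m) + atoms_before I m)%N.
Proof.
move=> pI; have cS (A : {set 'I_r}) : atoms_before A m = (\sum_(i in A) (i < m))%N.
  rewrite /atoms_before -sum1dep_card big_mkcondr; apply: eq_bigr => i _.
  by case: (_ < _)%N.
by rewrite !cS big_setU1.
Qed.

Section Generators.
Variable F : colouring R B.

(** Total in x, like [poset_gen]: it is 0 off rank r - n, so a vertex can be written without its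
    rank proof. *)
Definition cube_gen n y (u : F y) (x : B) : cube_obj L F n :=
  \sum_(c : cube_cell L n | val c == x)
    dsum_in (i := c) (col_trans F y (val c) u).

Lemma cube_gen_cell n y (u : F y) (c : cube_cell L n) :
  cube_gen n u (val c) = dsum_in (i := c) (col_trans F y (val c) u).
Proof. by rewrite /cube_gen (big_pred1 c). Qed.

Fact cube_gen_linear n y x : linear (fun u : F y => cube_gen n u x).
Proof.
move=> a u v; rewrite /cube_gen scaler_sumr -big_split /=.
by apply: eq_bigr => c _; rewrite !linearP.
Qed.

Lemma atoms_join_cell n (I : {set 'I_r}) : (#|I| + n = r)%N ->
  exists c : cube_cell L n, atoms_join I = val c.
Proof.
move=> In; have xr : (rk L (atoms_join I) + n == r)%N.
  by rewrite rk_atoms atoms_below_atoms_join In.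
by exists (exist (fun x => (rk L x + n == r)%N) _ xr).
Qed.

Lemma cube_diff_gen n y (u : F y) (I : {set 'I_r}) :
  (#|I| + n.+1 = r)%N -> (y <= atoms_join I)%O ->
  cube_diff L F n (cube_gen n.+1 u (atoms_join I)) =
  \sum_(m | m \notin I)
    (-1) ^+ atoms_before I m *: cube_gen n u (atoms_join (m |: I)).
Proof.
move=> In yI; have [c cE] := atoms_join_cell In.
rewrite {1}cE cube_gen_cell cube_diff_in.
transitivity (\sum_(z | covers (atoms_join I) z)
  cover_sign L R (atoms_join I) z *: cube_gen n u z).
  rewrite cE -sum_cube_cover; apply: eq_bigr => z cz.
  rewrite cube_gen_cell col_trans_comp //; first by rewrite -cE.
  exact: covers_le cz.
rewrite sum_covers_atoms_join; apply: eq_bigr => m mI; congr (_ *: _).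
by rewrite (@cover_signE _ _ _ _ _ _ _ m) !atoms_below_atoms_join.
Qed.

End Generators.

Variable F : colouring R B.
Local Notation P := (free_col F).

(** The atom l depends on y only and is not below y, so y stays below the smaller vertex. The sign
    is that of the cover restoring l. No atom exists for y = 1, where the value is 0. *)
Definition cube_remove n (c : cube_cell L n) y (a : F y) : cube_obj L P n.+1 :=
  let I := atoms_below L (val c) in
  if [pick l | l \notin atoms_below L y] is Some l then
    if l \in I then
      (-1) ^+ atoms_before I l *: cube_gen n.+1 (free_in a) (atoms_join (I :\ l))
    else 0
  else 0.

Fact cube_remove_linear n c y : linear (@cube_remove n c y).
Proof.
move=> k u v; rewrite /cube_remove; case: pickP => [l _|_]; last first.
  by rewrite scaler0 addr0.
case: ifP => _; last by rewrite scaler0 addr0.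
by rewrite linearP cube_gen_linear scalerDr !scalerA mulrC.
Qed.
HB.instance Definition _ n c y := GRing.isLinear.Build R (F y)
  (cube_obj L P n.+1) *:%R (@cube_remove n c y) (@cube_remove_linear n c y).

Definition cube_homotopy n : {linear cube_obj L P n -> cube_obj L P n.+1} :=
  free_ext (fun (c : cube_cell L n) y => @cube_remove n c y).

Lemma pick_notin_below y : y != \top%O ->
  exists l, [pick l | l \notin atoms_below L y] = Some l.
Proof.
move=> yT; case: pickP => [l _|noy]; first by exists l.
case/eqP: yT; apply: (@atoms_below_inj _ _ _ L); rewrite atoms_below_top.
by apply/setP => l; rewrite [RHS]in_setT; apply/negbFE/noy.
Qed.

Section Vertex.
Variables (y : B) (l : 'I_r) (a : F y).
Hypothesis ly : [pick l | l \notin atoms_below L y] = Some l.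

Lemma cube_homotopy_gen n (I : {set 'I_r}) :
  (#|I| + n = r)%N -> (y <= atoms_join I)%O ->
  cube_homotopy n (cube_gen n (free_in a) (atoms_join I)) =
  if l \in I then
    (-1) ^+ atoms_before I l *: cube_gen n.+1 (free_in a) (atoms_join (I :\ l))
  else 0.
Proof.
move=> In yI; have [c cE] := atoms_join_cell In.
rewrite {1}cE cube_gen_cell.
transitivity (cube_remove c a); last first.
  by rewrite /cube_remove ly -cE atoms_below_atoms_join.
apply: (free_ext_gen (lab := fun c : cube_cell L n => val c)).
by rewrite -cE.
Qed.

Lemma notin_picked : l \notin atoms_below L y.
Proof. by move: ly; case: pickP => // m mP [<-]. Qed.

(** After l is removed, the differential either puts l back, with the same sign twice, or adds some
    m outside I. *)
Lemma cube_diff_homotopy_gen n (I : {set 'I_r}) :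
  (#|I| + n = r)%N -> (y <= atoms_join I)%O -> l \in I ->
  cube_diff L P n (cube_homotopy n (cube_gen n (free_in a) (atoms_join I))) =
  cube_gen n (free_in a) (atoms_join I) +
  \sum_(m | m \notin I) (-1) ^+ (atoms_before I l + atoms_before (I :\ l) m) *:
    cube_gen n (free_in a) (atoms_join (m |: (I :\ l))).
Proof.
move=> In yI lI; rewrite cube_homotopy_gen // lI linearZ_LR cube_diff_gen; last first.
- by rewrite le_atoms_join subsetD1 notin_picked -le_atoms_join yI.
- by move: In; rewrite (cardsD1 l I) lI addnS.
rewrite scaler_sumr (bigD1 l) ?setD11 //= setD1K //.
have lJ : atoms_before I l = atoms_before (I :\ l) l.
  by rewrite -{1}(setD1K lI) atoms_beforeU1 ?setD11 // ltnn.
rewrite scalerA -exprD lJ addnn -mul2n exprM sqrrN !expr1n scale1r.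
congr (_ + _); apply: eq_big => m; first last.
  by move=> _; rewrite scalerA -exprD.
by rewrite !inE; have [->|_] := eqVneq m l; rewrite ?lI ?andbF ?andbT.
Qed.

End Vertex.

(** If l is in I, removing l and adding m anticommute, which leaves the vertex I. If not, h kills I,
    and in h(d I) only the addition of l survives, to be undone at once. *)
Lemma cube_homotopyP n (u : cube_obj L P n.+1) :
  cube_diff L P n.+1 (cube_homotopy n.+1 u) +
  cube_homotopy n (cube_diff L P n u) = u.
Proof.
pose f : {linear cube_obj L P n.+1 -> cube_obj L P n.+1} :=
  (cube_diff L P n.+1 \o cube_homotopy n.+1) \+
  (cube_homotopy n \o cube_diff L P n).
pose g : {linear cube_obj L P n.+1 -> cube_obj L P n.+1} := idfun.
suff: f =1 g by apply.
apply: free_linear_ext => c y a yc; rewrite /free_gen -cube_gen_cell.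
set v := cube_gen _ _ _.
rewrite -[f v]/(cube_diff L P n.+1 (cube_homotopy n.+1 v) +
  cube_homotopy n (cube_diff L P n v)) -[g v]/v {f g}/v.
have cr : (#|atoms_below L (val c)| + n.+1 = r)%N.
  by rewrite -rk_atoms; apply/eqP/(valP c).
move: yc cr; rewrite -[val c]atoms_join_atoms_below atoms_below_atoms_join.
move: (atoms_below L (val c)) => I yI In {c}.
(* The degree is positive, so I is not the full set and y, lying below it, is not 1. *)
have [|l ly] := @pick_notin_below y.
  apply: contraTneq yI => ->; rewrite le_atoms_join atoms_below_top subTset.
  apply: contraTneq (eqxx r) => IT; rewrite -[X in X != _]In IT cardsT card_ord.
  by rewrite -[X in _ != X]addn0 eqn_add2l.
rewrite [X in _ + cube_homotopy n X]cube_diff_gen // [X in _ + X]linear_sum.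
have hE m : m \notin I ->
    cube_homotopy n ((-1) ^+ atoms_before I m *:
      cube_gen n (free_in a) (atoms_join (m |: I))) =
    (-1) ^+ atoms_before I m *: if l \in m |: I then
      (-1) ^+ atoms_before (m |: I) l *:
        cube_gen n.+1 (free_in a) (atoms_join ((m |: I) :\ l)) else 0.
  move=> mI; rewrite linearZ /= (cube_homotopy_gen _ ly) //.
    by rewrite cardsU1 mI addSnnS.
  by rewrite le_atoms_join (subset_trans _ (subsetUr _ _)) -?le_atoms_join.
rewrite (eq_bigr _ hE) {hE}.
have [lI|lI] := boolP (l \in I).
  rewrite (cube_diff_homotopy_gen _ ly) // -addrA -big_split big1 ?addr0 // => m mI.
  rewrite in_setU1 lI orbT /=.
  have lm : l != m by apply: contraNneq mI => <-.
  have -> : (m |: I) :\ l = m |: (I :\ l).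
    by rewrite setDUl; congr (_ :|: _); apply/setDidPl; rewrite disjoints1 inE eq_sym.
  rewrite scalerA -exprD -scalerDl.
  have -> : atoms_before I m = ((l < m)%N + atoms_before (I :\ l) m)%N.
    by rewrite -{1}(setD1K lI) atoms_beforeU1 ?setD11.
  rewrite atoms_beforeU1 //; set p := atoms_before I l; set q := atoms_before _ m.
  (* Exactly one of l < m and m < l holds, which is the source of the opposite sign. *)
  have -> : ((l < m) + q + ((m < l) + p) = (p + q).+1)%N.
    case: ltngtP lm => [_ _|_ _|/val_inj->]; last by rewrite eqxx.
      by rewrite add0n add1n addSn addnC.
    by rewrite add0n add1n addnS addnC.
  by rewrite exprS mulN1r addrN scale0r.
rewrite (cube_homotopy_gen _ ly) // (negPf lI) linear0 add0r.
rewrite (bigD1 l) //= setU11 big1 ?addr0 => [|m /andP[mI ml]]; last first.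
  by rewrite in_setU1 (negPf lI) eq_sym (negPf ml) scaler0.
rewrite setU1K // atoms_beforeU1 // ltnn scalerA -exprD addnn -mul2n exprM.
by rewrite sqrrN !expr1n scale1r.
Qed.

Lemma free_cube_exact n (u : cube_obj L P n.+1) :
  cube_diff L P n u = 0 -> exists v, u = cube_diff L P n.+1 v.
Proof.
move=> du; exists (cube_homotopy n.+1 u).
by rewrite -{1}[u]cube_homotopyP du linear0 addr0.
Qed.

(** In degree 0 the only vertex is 1, from which every l can be removed, so the homotopy inverts d
    on all labels y except 1; there u vanishes by hypothesis. *)
Lemma free_cube_exact0 (u : cube_obj L P 0) :
  free_coef \top%O (u (top_cube_cell L) : P \top%O) = 0 ->
  exists v, u = cube_diff L P 0 v.
Proof.
move=> u0; exists (cube_homotopy 0 u).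
pose f : {linear cube_obj L P 0 -> cube_obj L P 0} :=
  cube_diff L P 0 \o cube_homotopy 0.
rewrite -[RHS]/(f u) [in RHS](free_decomp u) {1}(free_decomp u) [RHS]linear_sum.
apply: eq_bigr => c _; rewrite [RHS]linear_sum; apply: eq_bigr => y yc.
have [yT|yT] := eqVneq y \top%O.
  subst y; have -> : c = top_cube_cell L by apply/val_inj/cube_cell0.
  by rewrite u0 /free_gen !linear0.
have [l ly] := pick_notin_below yT.
move: (free_coef y (u c)) => a.
rewrite /free_gen -cube_gen_cell -[f _]/(cube_diff L P 0 (cube_homotopy 0 _)).
have cE : val c = atoms_join setT.
  by rewrite -(atoms_below_top L) atoms_join_atoms_below cube_cell0.
rewrite cE (cube_diff_homotopy_gen _ ly) ?inE //.
- by rewrite big_pred0 ?addr0 // => m; rewrite inE.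
- by rewrite cardsT card_ord addn0.
by rewrite le_atoms_join subsetT.
Qed.

End FreeCubeHomotopy.

(** * Exactness of the cone by dimension shifting, and the theorem *)

Section QuasiIsomorphism.
Variables (R : comPzRingType) (r : nat) (d : Order.disp_t).
Variables (B : finTBLatticeType d) (L : boolean_lattice r B).

Lemma phi_into_top (F : colouring R B) weak (u : cube_obj L F 0) :
  phi_into L F weak 0 u (empty_chain B weak) = u (top_cube_cell L).
Proof.
rewrite [in LHS](dsum_decomp u) (big_pred1 (top_cube_cell L)) => [|c] /=; last first.
  by symmetry; apply/eqP/val_inj/cube_cell0.
rewrite phi_into_in0 -[[::]]/(chain_seq (empty_chain B weak)) poset_gen_chain.
by rewrite dsum_in_id col_trans_id.
Qed.

(** First k is filled by exactness of the cube complex; then phi(k') - c is a cycle of positive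
    degree and bounds in the poset complex. *)
Lemma cone_exact_free (F : colouring R B) weak n :
  cone_exact (phi_into L (free_col F) weak) n.+1.
Proof.
move=> k c kc fk; have [k' kE] : exists k', k = cube_diff L (free_col F) n k'.
  case: n k c kc fk => [|n] k c kc fk; last by apply/free_cube_exact/eqP.
  (* In degree 0, phi preserves the coefficient with label 1, and phi(k) is a boundary, so this
     coefficient of k is 0. *)
  by apply: free_cube_exact0; rewrite -(phi_into_top weak) fk free_coef_poset_diff0.
have [|c' cE] := @free_poset_exact _ _ _ F weak n (phi_into L (free_col F) weak n.+1 k' - c).
  rewrite linearB; apply/eqP; rewrite subr_eq0; apply/eqP.
  by rewrite -[RHS]fk kE; symmetry; apply: (chain_map_comm (phi_into L (free_col F) weak)).
by exists k', c'.
Qed.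

(** The induction on n quantifies over F, since its step passes from F to [syzygy_col F]. *)
Lemma cone_exact_phi_into (F : colouring R B) weak n :
  cone_exact (phi_into L F weak) n.
Proof.
elim: n F => [|n IH] F; first exact: cone_exact_phi_into0.
have res := free_resolution F.
apply: (cone_exact_shift (cube_map_exact L res) (poset_map_exact res weak)
  _ _ (IH _) (@cone_exact_free F weak n)) => m u; exact: phi_into_nat.
Qed.

End QuasiIsomorphism.

Theorem mainTheorem1 (R : comPzRingType) (r : nat) (d : Order.disp_t)
    (B : finTBLatticeType d) (L : boolean_lattice r B) (F : colouring R B) :
  exists Phi : chain_map (cube_complex L F) (strict_complex F),
    [/\ forall n, Phi n =1 phi L F n,
        quasi_isomorphism Phi
      & forall n, exists f : {linear cube_homology L F n -> coloured_homology F n},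
          f =1 homology_map (poset_incl F) n \o homology_map Phi n
          /\ bijective f].
Proof.
exists (phi_map L F); split=> //.
  exact: cone_exact_quasi_isomorphism (@cone_exact_phi_into R r d B L F false).
(* The composite into S is itself a quasi-isomorphism by the case [weak = true]. *)
move=> n; exists (homology_map (phi_into L F true) n); split.
  exact: homology_map_comp.
exact: cone_exact_quasi_isomorphism (@cone_exact_phi_into R r d B L F true) n.
Qed.
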